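(* Let $G^{\nu}$ be a wconnected $\nu$-wgraph with $2\le\nu\le\omega$ (possibly $\nu=\vec{\omega}$), let $\rho\le\nu$ be either a natural number or $\omega$ (not $\vec{\omega}$), and let $S^{\rho}$ be a $\rho$-wsection of $G^{\nu}$. Suppose that the enlargement ${}^{*}S^{\rho}$ has a hypernode $\mathbf{v}=[v_{n}]$ (of any rank $\alpha$ with $0\le\alpha\le\rho$) that is not in the principal $\rho$-galaxy $\Gamma^{\rho}_{0}$ of ${}^{*}S^{\rho}$. Then there exists a two-way infinite sequence of $\rho$-galaxies of ${}^{*}S^{\rho}$ that is totally ordered according to closeness to $\Gamma^{\rho}_{0}$, with $\mathbf{v}$ being in one of the galaxies of the sequence.
   Context: Ranks and ordinals. Ranks are the natural numbers $0,1,2,\dots$, the formal rank $\vec{\omega}$ (larger than all natural numbers and smaller than $\omega$), and $\omega$. For a rank $\rho=\omega$, ''$\rho-1$'' means $\vec{\omega}$. Ordinals are in Cantor normal form and are added by natural (Hessenberg) summation. $\mathcal{F}$ is a fixed free ultrafilter on $\mathbb{N}$. Wgraphs. A $0$-graph is $\{X^{0},B\}$, with $X^{0}$ a set of $0$-nodes and $B$ a set of branches, i.e. two-element subsets of $X^0$. A $0$-walk is an alternating sequence $\langle\dots,x_m,b_m,x_{m+1},\dots\rangle$ of $0$-nodes and branches, indexed by consecutive integers, with $b_m$ incident to $x_m$ and $x_{m+1}$, ending at a $0$-node wherever it terminates; repetitions are allowed. It is two-ended (finite), one-ended (one-way infinite) or endless (two-way infinite). A $(-1)$-tip is an end of a branch;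 a $0$-node embraces itself and the $(-1)$-tips of its incident branches. Recursively, for a natural number $\rho$, a $\rho$-wtip is an equivalence class of one-ended $\rho$-walks, two being equivalent if they are identical from some point on, up to a shift of indices. Partition the set of all $\rho$-wtips into nonempty subsets $T_i$; a $(\rho+1)$-wnode is a set $T_i\cup N_i$, where $N_i$ is empty or a singleton whose member (the exceptional element) is a wnode of rank at most $\rho$, and each wnode is the exceptional element of at most one wnode of higher rank. A wnode embraces itself, its elements, and everything embraced by its exceptional element. For $\rho\ge1$, a $\rho$-walk is an alternating sequence $\langle\dots,x_m,W_m,x_{m+1},W_{m+1},\dots\rangle$ indexed by consecutive integers, where the nonterminal $x_m$ are $\rho$-wnodes, a terminal element (wherever the sequence terminates) is a wnode of rank at most $\rho$, and each $W_m$ is a nontrivial walk of rank at most $\rho-1$ that reaches $x_m$ on its left and $x_{m+1}$ on its right (i.e. on that side it either terminates at a wnode embraced by that wnode or is infinite with its wtip embraced by that wnode), such that for each nonterminal $x_m$ at least one of $W_{m-1},W_m$ reaches $x_m$ through a $(\rho-1)$-wtip. Two-ended, one-ended and endless are as for $0$-walks. An $\vec{\omega}$-wnode is a maximal infinite chain of wnodes of strictly increasing natural-number ranks, each the exceptional element of the next; it embraces everything its members embrace. A one-ended $\vec{\omega}$-walk is a sequence $\langle x_0,W_0,x_1,W_1,\dots\rangle$ with $x_m$ a wnode of natural-number rank $\mu_m$, $\mu_0<\mu_1<\cdots$, and $W_m$ a walk of rank less than $\mu_{m+1}$ reaching $x_m$ and $x_{m+1}$, the latter through a $(\mu_{m+1}-1)$-wtip;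 an endless one joins two of these at their starting wnodes; $\vec{\omega}$-wtips are classes of eventually identical one-ended $\vec{\omega}$-walks (up to merging consecutive pieces). Partition the set of all $\vec{\omega}$-wtips into nonempty subsets $T_i$; an $\omega$-wnode is a set $T_i\cup N_i$, where $N_i$ is empty or a singleton whose member (the exceptional element) is a wnode of rank at most $\vec{\omega}$, and each wnode is the exceptional element of at most one wnode of higher rank; an $\omega$-wnode embraces itself, its elements, and everything embraced by its exceptional element. An $\omega$-walk is an alternating sequence $\langle\dots,x_m,W_m,x_{m+1},W_{m+1},\dots\rangle$ indexed by consecutive integers, where the nonterminal $x_m$ are $\omega$-wnodes, a terminal element (wherever the sequence terminates) is a wnode of rank at most $\omega$, and each $W_m$ is a nontrivial walk of rank at most $\vec{\omega}$ that reaches $x_m$ on its left and $x_{m+1}$ on its right, such that for each nonterminal $x_m$ at least one of $W_{m-1},W_m$ reaches $x_m$ through an $\vec{\omega}$-wtip; it is two-ended, one-ended or endless according to whether the sequence is finite, one-way infinite or two-way infinite. A $\nu$-wgraph is $G^{\nu}=\{X^{0},B,X^{1},\dots,X^{\nu}\}$, with $X^{\gamma}$ the set of $\gamma$-wnodes, nonempty except possibly for $\gamma=\vec{\omega}$. It is wconnected if every two wnodes are the terminal wnodes of some two-ended walk in it. Lengths and wdistance. The length $|W|$ of a two-ended $0$-walk is its number of branch traversals. For a natural number or $\omega$ as rank $\gamma$, a one-ended $\gamma$-walk has length $\omega^{\gamma+1}$ and an endless one $\omega^{\gamma+1}\cdot2$; a one-ended (endless) $\vec{\omega}$-walk has length $\omega^{\omega}$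 ($\omega^{\omega}\cdot 2$). A two-ended $\gamma$-walk with $\gamma\ge1$ has length the natural sum of the lengths of its constituent walks $W_m$. A wnode is maximal if it is not embraced by a wnode of higher rank. The wdistance is $d(x,y)=\min|W|$ over two-ended walks $W$ terminating at $x$ and $y$, where a walk terminating at a wnode is also regarded as terminating at any wnode embracing it and wdistances from a nonmaximal wnode equal those from the maximal wnode embracing it; $d(x,y)=0$ if $x,y$ are embraced by the same maximal wnode. Wsections. A $\rho$-wsection $S^{\rho}$ of $G^{\nu}$ ($\rho<\nu$) is a maximal wsubgraph of the $\rho$-wgraph $\{X^{0},B,\dots,X^{\rho}\}$ that is $\rho$-wconnected: every two of its wnodes are joined by a two-ended $\alpha$-walk with $\alpha\le\rho$ ($\alpha<\vec{\omega}$ if $\rho=\vec{\omega}$). It consists of a set of branches together with the wnodes of rank at most $\rho$ embracing a tip having a representative in those branches. The only $\nu$-wsection is $G^{\nu}$ itself. A wsection $S^\rho$ is a $\rho$-wgraph by itself, with wdistance $d$. Enlargement. A $\gamma$-hypernode of ${}^{*}S^{\rho}$ is an equivalence class $\mathbf{x}=[x_n]$ of sequences of $\gamma$-wnodes of $S^{\rho}$, two sequences being equivalent if they agree on a set of indices in $\mathcal{F}$. A hyperbranch is a pair $\{[x_n],[y_n]\}$ of $0$-hypernodes with $\{n:\{x_n,y_n\}\text{ is a branch of }S^{\rho}\}\in\mathcal{F}$. The enlargement ${}^{*}S^{\rho}$ consists of all hypernodes of all ranks at most $\rho$ and all hyperbranches. A hypernode is standard if it is represented by a constant sequence. Galaxies.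 For $\rho$ a natural number or $\omega$, hypernodes $\mathbf{x}=[x_n]$ and $\mathbf{y}=[y_n]$ (of any ranks) are $\rho$-limitedly distant if there is $\mu\in\mathbb{N}$ with $\{n: d(x_n,y_n)\le\omega^{\rho}\cdot\mu\}\in\mathcal{F}$. This is an equivalence relation on hypernodes; its classes are the nodal $\rho$-galaxies, and a $\rho$-galaxy consists of the hypernodes of a nodal $\rho$-galaxy together with the hyperbranches whose $0$-hypernodes lie in it. The principal $\rho$-galaxy $\Gamma_0^{\rho}$ is the one whose hypernodes are $\rho$-limitedly distant from a standard hypernode. Closeness. For $\rho$-galaxies $\Gamma_a^{\rho},\Gamma_b^{\rho}$ of ${}^{*}S^{\rho}$ different from $\Gamma_0^{\rho}$, $\Gamma_a^{\rho}$ is closer to $\Gamma_0^{\rho}$ than is $\Gamma_b^{\rho}$ (and $\Gamma_b^{\rho}$ is further away from $\Gamma_0^\rho$ than is $\Gamma_a^\rho$) if there are $\mathbf{y}=[y_n]$ in $\Gamma_a^{\rho}$ and $\mathbf{z}=[z_n]$ in $\Gamma_b^{\rho}$ such that, for some $\mathbf{x}=[x_n]$ in $\Gamma_0^{\rho}$ and every $m\in\mathbb{N}$, $\{n: d(z_n,x_n)-d(y_n,x_n)\ge\omega^{\rho}\cdot m\}\in\mathcal{F}$; here the inequality means $d(z_n,x_n)\ge d(y_n,x_n)+\omega^{\rho}\cdot m$. A set of $\rho$-galaxies is totally ordered according to closeness to $\Gamma_0^\rho$ if of every two distinct members one is closer to $\Gamma_0^{\rho}$ than the other. A totally ordered set is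 a two-way infinite sequence if there is an order-preserving bijection from $\mathbb{Z}$ onto it. *)

(* Defs.v *)
From HB Require Import structures.
From mathcomp Require Import all_boot all_order all_algebra.
From mathcomp Require Import finmap multiset.
From mathcomp Require Import boolp classical_sets functions filter.

Set Implicit Arguments.
Unset Strict Implicit.
Unset Printing Implicit Defensive.

Import Order.TTheory GRing.Theory Num.Theory.
Local Open Scope classical_set_scope.
Local Open Scope ring_scope.

(* [VecOmega] is the rank between all natural numbers and [Omega]. *)
Inductive rank := Fin of nat | VecOmega | Omega.

Definition rle (r s : rank) : bool :=
  match r, s with
  | Fin m, Fin n => (m <= n)%N
  | Fin _, _ => true
  | VecOmega, Fin _ => false
  | VecOmega, _ => true
  | Omega, Omega => true
  | Omega, _ => false
  end.

Definition rlt (r s : rank) : bool := ~~ rle s r.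

Definition rpred (r : rank) : option rank :=
  match r with
  | Fin n.+1 => Some (Fin n)
  | Omega => Some VecOmega
  | _ => None
  end.

Definition natural_rank (r : rank) : Prop := exists n, r = Fin n.

(* Ordinals below omega^(omega * omega), in Cantor normal form: the finite
   multiset of the exponents, the exponent (a, b) standing for omega * a + b.
   The natural sum adds multiplicities; two normal forms are compared at the
   largest exponent at which they differ. *)
Definition expo := (nat *l nat)%type.
Definition ord := {mset expo}%mset.

Definition wpow (e : expo) (k : nat) : ord := msetn k e.

Definition nsum (a b : ord) : ord := (a `+` b)%mset.

Definition ole (a b : ord) : Prop :=
  a = b \/ exists e : expo, (a e < b e)%N /\
                            forall f : expo, (e < f)%O -> a f = b f.

(* The exponent gamma + 1 of the length of an infinite gamma-walk; it is
   omega for gamma = VecOmega. *)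
Definition expo_len (r : rank) : expo :=
  match r with
  | Fin n => (0%N, n.+1)
  | VecOmega => (1%N, 0%N)
  | Omega => (1%N, 1%N)
  end.

(* The rank itself as an exponent; only used for ranks other than VecOmega. *)
Definition expo_rank (r : rank) : expo :=
  match r with
  | Fin n => (0%N, n)
  | _ => (1%N, 0%N)
  end.

(* [Branch a b] is the branch {a, b} traversed from a to b.
   [Walk r lo hi x W] is the alternating sequence of the x_m (lo <= m <= hi)
   and the W_m (lo <= m < hi), regarded as a walk of rank r; W_m stands
   between x_m and x_(m+1), and [None] marks an infinite side.  The values of
   x and W outside these ranges are irrelevant.  The pieces of a 0-walk are
   branches.  Whether such a term is a walk of a given wgraph is decided by
   [is_walk] below. *)
Inductive prewalk (X : Type) : Type :=
| Branch of X & X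
| Walk of rank & option int & option int & (int -> X) & (int -> prewalk X).

Definition ge_lo (lo : option int) (m : int) : bool :=
  if lo is Some a then a <= m else true.
Definition le_hi (hi : option int) (m : int) : bool :=
  if hi is Some b then m <= b else true.
Definition in_nodes (lo hi : option int) (m : int) : bool :=
  ge_lo lo m && le_hi hi m.
Definition in_pieces (lo hi : option int) (m : int) : bool :=
  ge_lo lo m && le_hi hi (m + 1).
Definition nonterminal (lo hi : option int) (m : int) : bool :=
  ge_lo lo (m - 1) && le_hi hi (m + 1).

Section Prewalks.
Variable X : Type.
Implicit Type w : prewalk X.

Definition walk_rank w : rank :=
  if w is Walk r _ _ _ _ then r else Fin 0.

Definition left_infinite w : Prop :=
  if w is Walk _ None _ _ _ then True else False.
Definition right_infinite w : Prop :=
  if w is Walk _ _ None _ _ then True else False.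

Definition nontrivial w : Prop :=
  if w is Walk _ lo hi _ _ then exists m, in_pieces lo hi m else False.

(* w is two-ended, with terminal elements a (left) and b (right). *)
Definition two_ended_between (a b : X) w : Prop :=
  if w is Walk _ (Some i) (Some j) x _ then x i = a /\ x j = b else False.

Fixpoint rev_walk w : prewalk X :=
  match w with
  | Branch a b => Branch b a
  | Walk r lo hi x W =>
      Walk r (omap -%R hi) (omap -%R lo)
        (fun m => x (- m)) (fun m => rev_walk (W (- m - 1)))
  end.

(* The part of w from its element of index m on. *)
Definition tail (m : int) w : prewalk X :=
  match w with
  | Branch a b => Branch a b
  | Walk r _ hi x W => Walk r (Some m) hi x W
  end.

(* The nodes and branches occurring in w, at any depth, are in P and B. *)
Fixpoint walk_in (P : set X) (B : X -> X -> Prop) w : Prop :=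
  match w with
  | Branch a b => B a b
  | Walk _ lo hi x W =>
      (forall m, in_nodes lo hi m -> P (x m)) /\
      (forall m, in_pieces lo hi m -> walk_in P B (W m))
  end.

Fixpoint walk_length w : ord :=
  match w with
  | Branch _ _ => wpow (0%N, 0%N) 1
  | Walk _ (Some a) (Some b) _ W =>
      \big[nsum/mset0%mset]_(i < `|b - a|%N) walk_length (W (a + i%:Z))
  | Walk r None None _ _ => wpow (expo_len r) 2
  | Walk r _ _ _ _ => wpow (expo_len r) 1
  end.

(* Identity of walks as alternating sequences, up to shifts of indices in the
   walk and in its constituents.  The rank labels need not be compared: that
   of an infinite walk is determined by its nodes, and a two-ended walk of
   one rank may at the same time be one of another rank. *)
Inductive same_walk : prewalk X -> prewalk X -> Prop :=
| same_branch a b : same_walk (Branch a b) (Branch a b)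
| same_sequence r r' lo hi lo' hi' x x' W W' (k : int) :
    lo' = omap (+%R k) lo ->
    hi' = omap (+%R k) hi ->
    (forall m, in_nodes lo hi m -> x m = x' (k + m)) ->
    (forall m, in_pieces lo hi m -> same_walk (W m) (W' (k + m))) ->
    same_walk (Walk r lo hi x W) (Walk r' lo' hi' x' W').

Definition eventually_identical w w' : Prop :=
  exists m m' : int,
    [/\ (if w is Walk _ lo hi _ _ then in_nodes lo hi m else False),
        (if w' is Walk _ lo hi _ _ then in_nodes lo hi m' else False)
      & same_walk (tail m w) (tail m' w')].

(* Erasing the bracketing of a walk leaves a linearly ordered family of
   nonterminal nodes and branch traversals.  The position of an entry is the
   list of indices leading to it, ordered lexicographically; (m, false) leads
   to x_m and (m, true) into W_m.  [entry w p l]: the entry at p is l. *)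
Definition position := seqlexi (int *l bool)%type.

Inductive entry : prewalk X -> position -> X + X * X -> Prop :=
| entry_branch a b : entry (Branch a b) [::] (inr (a, b))
| entry_node r lo hi x W m :
    nonterminal lo hi m ->
    entry (Walk r lo hi x W) [:: (m, false)] (inl (x m))
| entry_piece r lo hi x W m p l :
    in_pieces lo hi m -> entry (W m) p l ->
    entry (Walk r lo hi x W) ((m, true) :: p) l.

Definition positions w : set position := [set p | exists l, entry w p l].
Definition positions_from w (p : position) : set position :=
  [set q | positions w q /\ (p <= q)%O].

(* Merging consecutive pieces of a walk changes only its bracketing, so two
   walks are eventually identical up to such mergers when their unbracketed
   sequences coincide from some entries on. *)
Definition eventually_identical_up_to_merging w w' : Prop :=
  exists (p0 p0' : position) (f : position -> position),
    [/\ positions w p0, positions w' p0',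
        set_bij (positions_from w p0) (positions_from w' p0') f,
        (forall p q, positions_from w p0 p -> positions_from w p0 q ->
           (p < q)%O -> (f p < f q)%O)
      & (forall p l, positions_from w p0 p -> entry w p l ->
           entry w' (f p) l)].

Definition same_tip (r : rank) w w' : Prop :=
  if r is VecOmega then eventually_identical_up_to_merging w w'
  else eventually_identical w w'.

End Prewalks.

(* Raw data of a wgraph.  [adj x y] says that {x, y} is a branch, [exc x] is
   the exceptional element of x, [tips x] is the set of the wtips that are
   elements of x, each wtip being a set of one-ended walks, and [chain x] is
   the chain of wnodes that x consists of when x has rank VecOmega. *)
Record wdata := WData {
  node :> Type;
  rk : node -> rank;
  adj : node -> node -> Prop;
  exc : node -> option node;
  tips : node -> set (set (prewalk node));
  chain : node -> nat -> node
}.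

Section Wgraphs.
Variable G : wdata.
Implicit Types (x y : G) (w : prewalk G) (t : set (prewalk G)).

Inductive embraces : G -> G -> Prop :=
| embraces_refl x : embraces x x
| embraces_exc x y z : exc x = Some y -> embraces y z -> embraces x z
| embraces_chain x i z :
    rk x = VecOmega -> embraces (chain x i) z -> embraces x z.

Definition embraces_tip x t : Prop := exists2 y, embraces x y & tips y t.

(* w reaches x on its right, resp. on its left.  A left-infinite end is
   described by the wtip of the reversed walk. *)
Definition reaches_right w x : Prop :=
  match w with
  | Branch _ _ => False
  | Walk _ _ (Some j) y _ => embraces x (y j)
  | Walk _ lo None _ _ =>
      exists m t, [/\ ge_lo lo m, embraces_tip x t & t (tail m w)]
  end.
Definition reaches_left w x : Prop := reaches_right (rev_walk w) x.

(* ... and it does so through an r-wtip. *)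
Definition reaches_right_by (r : rank) w x : Prop :=
  [/\ right_infinite w, walk_rank w = r & reaches_right w x].
Definition reaches_left_by (r : rank) w x : Prop :=
  [/\ left_infinite w, walk_rank w = r & reaches_left w x].

(* In the case [VecOmega], c is the index of the node from which the ranks of
   the nodes increase (towards the right, the left, or both). *)
Fixpoint is_walk w : Prop :=
  match w with
  | Branch _ _ => False
  | Walk r lo hi x W =>
    (if (lo, hi) is (Some a, Some b) then a <= b else True) /\
    match r with
    | Fin 0 =>
        (forall m, in_nodes lo hi m -> rk (x m) = Fin 0) /\
        (forall m, in_pieces lo hi m ->
           W m = Branch (x m) (x (m + 1)) /\ adj (x m) (x (m + 1)))
    | VecOmega =>
        exists c : int,
        [/\ (if lo is Some a then c = a else True),
            (if hi is Some b then c = b else True),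
            lo = None \/ hi = None,
            (forall m, in_nodes lo hi m -> natural_rank (rk (x m)))
          & forall m, in_pieces lo hi m ->
            [/\ is_walk (W m), nontrivial (W m),
                reaches_left (W m) (x m), reaches_right (W m) (x (m + 1))
              & if c <= m then
                  [/\ rlt (rk (x m)) (rk (x (m + 1))),
                      rlt (walk_rank (W m)) (rk (x (m + 1)))
                    & exists2 p, rpred (rk (x (m + 1))) = Some p
                               & reaches_right_by p (W m) (x (m + 1))]
                else
                  [/\ rlt (rk (x (m + 1))) (rk (x m)),
                      rlt (walk_rank (W m)) (rk (x m))
                    & exists2 p, rpred (rk (x m)) = Some p
                               & reaches_left_by p (W m) (x m)]]]
    | _ =>
        [/\ (forall m, in_nodes lo hi m -> rle (rk (x m)) r),
            (forall m, nonterminal lo hi m -> rk (x m) = r),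
            (forall m, in_pieces lo hi m ->
               [/\ is_walk (W m), nontrivial (W m), rlt (walk_rank (W m)) r,
                   reaches_left (W m) (x m)
                 & reaches_right (W m) (x (m + 1))])
          & (forall m, nonterminal lo hi m ->
               exists2 p, rpred r = Some p
                 & reaches_right_by p (W (m - 1)) (x m) \/
                   reaches_left_by p (W m) (x m))]
    end
  end.

Definition one_ended (r : rank) w : Prop :=
  [/\ is_walk w, walk_rank w = r, ~ left_infinite w & right_infinite w].

Definition is_wtip (r : rank) t : Prop :=
  exists2 w, one_ended r w
    & t = [set w' | one_ended r w' /\ same_tip r w w'].

(* The chain is maximal: upwards because it is infinite, downwards because
   its first member has no exceptional element. *)
Definition max_chain (c : nat -> G) : Prop :=
  [/\ exc (c 0%N) = None,
      (forall i, exc (c i.+1) = Some (c i)),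
      (forall i, rlt (rk (c i)) (rk (c i.+1)))
    & (forall i, natural_rank (rk (c i)))].

Record is_wgraph (nu : rank) : Prop := IsWgraph {
  wg_rank : forall x, rle (rk x) nu;
  wg_nonempty : forall r, rle r nu -> r <> VecOmega -> exists x, rk x = r;
  wg_adj_rank : forall x y, adj x y -> rk x = Fin 0 /\ rk y = Fin 0;
  wg_adj_sym : forall x y, adj x y -> adj y x;
  wg_adj_irr : forall x, ~ adj x x;
  wg_exc_rank : forall x y, exc x = Some y -> rlt (rk y) (rk x);
  wg_exc_uniq : forall x y z, exc x = Some z -> exc y = Some z -> x = y;
  (* the nodes of rank r partition the wtips of rank r - 1 *)
  wg_tips : forall x r, rpred (rk x) = Some r ->
    tips x !=set0 /\ forall t, tips x t -> is_wtip r t;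
  wg_tips_uniq : forall r s t, rle s nu -> rpred s = Some r -> is_wtip r t ->
    exists! x, rk x = s /\ tips x t;
  wg_tips_none : forall x, rpred (rk x) = None -> tips x = set0;
  (* the nodes of rank VecOmega are the maximal infinite chains *)
  wg_chain : forall x, rk x = VecOmega -> max_chain (chain x) /\ exc x = None;
  wg_chain_uniq : forall c, max_chain c ->
    exists! x, rk x = VecOmega /\ chain x = c
}.

Record wsubgraph := WSubgraph {
  sadj : G -> G -> Prop;
  snode : set G
}.

Definition whole : wsubgraph := WSubgraph (@adj G) setT.

(* x embraces a tip with a representative in B; the (-1)-tips embraced by a
   0-node are the ends there of its incident branches. *)
Definition embraces_tip_of (B : G -> G -> Prop) x : Prop :=
  (exists y z, embraces x y /\ B y z) \/
  (exists t w, [/\ embraces_tip x t, t w & walk_in setT B w]).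

(* S is a wsubgraph of the rho-wgraph {X^0, B, ..., X^rho}. *)
Definition is_wsubgraph (rho : rank) (S : wsubgraph) : Prop :=
  [/\ (forall x y, sadj S x y -> adj x y),
      (forall x y, sadj S x y -> sadj S y x)
    & snode S = [set x | rle (rk x) rho /\ embraces_tip_of (sadj S) x]].

Section Subgraph.
Variables (rho : rank) (S : wsubgraph).

Definition walk_of w : Prop :=
  [/\ is_walk w, rle (walk_rank w) rho & walk_in (snode S) (sadj S) w].

(* A walk terminating at a wnode also terminates at the wnodes embracing it. *)
Definition joined x y : Prop :=
  exists w a b, [/\ walk_of w, two_ended_between a b w,
                    embraces x a & embraces y b].

Definition wconnected : Prop :=
  forall x y, snode S x -> snode S y -> joined x y.

Definition maximal_node x : Prop :=
  snode S x /\
  forall y, snode S y -> embraces y x -> ~ rlt (rk x) (rk y).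

Definition walk_lengths x y : set ord :=
  [set d | exists w a b X Y,
     [/\ walk_of w /\ two_ended_between a b w,
         [/\ maximal_node X, embraces X x & embraces X a],
         [/\ maximal_node Y, embraces Y y & embraces Y b]
       & d = walk_length w]].

Definition wdist x y : ord :=
  if `[< exists X, [/\ maximal_node X, embraces X x & embraces X y] >]
  then mset0%mset
  else xget mset0%mset
         [set d | walk_lengths x y d /\
                  forall e, walk_lengths x y e -> ole d e].

End Subgraph.

Definition sub_wsubgraph (S S' : wsubgraph) : Prop :=
  (forall x y, sadj S x y -> sadj S' x y) /\ snode S `<=` snode S'.

Definition is_wsection (nu rho : rank) (S : wsubgraph) : Prop :=
  (rho = nu /\ S = whole) \/
  [/\ rlt rho nu, is_wsubgraph rho S, wconnected rho S
    & forall S', is_wsubgraph rho S' -> wconnected rho S' ->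
        sub_wsubgraph S S' -> sub_wsubgraph S' S].

End Wgraphs.

Definition free_ultrafilter (F : set_system nat) : Prop :=
  UltraFilter F /\ \bigcap_(A in F) A = set0.

(* A hypernode is an equivalence class of sequences of nodes, a hyperbranch
   an unordered pair of hypernodes. *)
Definition hypernode (G : wdata) := set (nat -> G).
Definition hyperbranch (G : wdata) := set (hypernode G).

Record galaxy (G : wdata) := Galaxy {
  gnodes : set (hypernode G);
  gbranches : set (hyperbranch G)
}.

Section Enlargement.
Variables (G : wdata) (rho : rank) (S : wsubgraph G) (F : set_system nat).

Definition rank_sequence (gamma : rank) (x : nat -> G) : Prop :=
  forall n, snode S (x n) /\ rk (x n) = gamma.

Definition hyperclass (gamma : rank) (x : nat -> G) : hypernode G :=
  [set y | rank_sequence gamma y /\ F [set n | x n = y n]].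

Definition is_hypernode_of_rank (gamma : rank) (H : hypernode G) : Prop :=
  exists2 x, rank_sequence gamma x & H = hyperclass gamma x.

Definition is_hypernode (H : hypernode G) : Prop :=
  exists2 gamma, rle gamma rho & is_hypernode_of_rank gamma H.

Definition standard (H : hypernode G) : Prop :=
  is_hypernode H /\ exists a : G, H (fun=> a).

Definition is_hyperbranch (b : hyperbranch G) : Prop :=
  exists x y, [/\ rank_sequence (Fin 0) x, rank_sequence (Fin 0) y,
                  F [set n | sadj S (x n) (y n)]
                & b = [set hyperclass (Fin 0) x; hyperclass (Fin 0) y]].

Definition limitedly_distant (H K : hypernode G) : Prop :=
  exists x y, [/\ H x, K y
    & exists mu : nat,
        F [set n | ole (wdist rho S (x n) (y n)) (wpow (expo_rank rho) mu)]].

Definition galaxy_on (N : set (hypernode G)) : galaxy G :=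
  Galaxy N [set b | is_hyperbranch b /\ b `<=` N].

Definition is_galaxy (g : galaxy G) : Prop :=
  exists2 H, is_hypernode H
    & g = galaxy_on [set K | is_hypernode K /\ limitedly_distant H K].

Definition principal_galaxy : galaxy G :=
  galaxy_on [set K | is_hypernode K /\
                     exists2 H, standard H & limitedly_distant H K].

Definition closer (a b : galaxy G) : Prop :=
  [/\ is_galaxy a /\ a <> principal_galaxy,
      is_galaxy b /\ b <> principal_galaxy
    & exists y z x : nat -> G,
      [/\ (exists2 H, gnodes a H & H y),
          (exists2 H, gnodes b H & H z),
          (exists2 H, gnodes principal_galaxy H & H x)
        & forall m : nat,
            F [set n | ole (nsum (wdist rho S (y n) (x n))
                                 (wpow (expo_rank rho) m))
                           (wdist rho S (z n) (x n))]]].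

Definition totally_ordered (C : set (galaxy G)) : Prop :=
  forall a b, C a -> C b -> a <> b -> closer a b \/ closer b a.

Definition two_way_infinite (C : set (galaxy G)) : Prop :=
  exists g : int -> galaxy G,
    set_bij setT C g /\ forall i j : int, i < j -> closer (g i) (g j).

End Enlargement.

(* Main.v *)
Require Import Defs.
From mathcomp Require Import all_boot all_order all_algebra.
From mathcomp Require Import finmap multiset zify.
From mathcomp Require Import boolp classical_sets functions filter.
Local Open Scope classical_set_scope.

(** Let c(x, y) be the coefficient of omega^rho in the Cantor normal form of
d(x, y).  No larger exponent occurs in d(x, y), so c decides all comparisons up
to an error of 1; it is symmetric and satisfies the triangle inequality because
two walks meeting at a maximal wnode can be concatenated.  If no wtip of rank
rho - 1 is used at the meeting point, the two walk pieces there are first merged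
into one, by induction on the rank; a VecOmega-piece absorbs a walk of natural
rank together with its own terms up to one of sufficiently large rank.

Each piece of a rho-walk contributes at most 2 to c.  Hence, along a walk from a
to a wnode at coefficient c, every smaller value is met up to 2 by a nonterminal,
i.e. at a wnode of rank exactly rho.  As v is not principal, c_n = c(a, v_n) is
unlimited, and the galaxies of wnodes at coefficient about c_n (k + 1) and
c_n / (k + 1), k = 0, 1, 2, ..., form the desired sequence. *)

Set Implicit Arguments.
Unset Strict Implicit.
Unset Printing Implicit Defensive.

Import Order.TTheory GRing.Theory Num.Theory.

(** * Ranks *)

(** The obstacle is the triangle inequality. Two rho-walks that meet do not form a rho-walk when
    simply put one after the other: at a nonterminal wnode one of the adjacent pieces must arrive
    through a (rho - 1)-wtip, and the two walks may terminate at different wnodes embraced by the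
    same maximal one. Most of the proof repairs such a junction without letting any coefficient
    exceed the sum of the two lengths and without disturbing the outer ends. The latter needs care
    because an infinite end is recorded by a wtip, a class of walks, and this class has to survive
    cutting, gluing and reindexing.

    The intermediate wnodes must have rank exactly rho because all wnodes of a sequence that
    represents a hypernode have the same rank; arbitrary wnodes met on the way could have ranks that
    vary with n. *)

Lemma rle_refl r : rle r r.
Proof. by case: r => //= n; rewrite leqnn. Qed.

Lemma rle_trans s r t : rle r s -> rle s t -> rle r t.
Proof. by case: r s t => [a||] [b||] [c||] //=; lia. Qed.

Lemma rle_anti r s : rle r s -> rle s r -> r = s.
Proof. by case: r s => [a||] [b||] //= h1 h2; congr Fin; lia. Qed.

Lemma rltW r s : rlt r s -> rle r s.
Proof. by case: r s => [a||] [b||] //=; rewrite /rlt /=; lia. Qed.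

Lemma rle_lt_trans s r t : rle r s -> rlt s t -> rlt r t.
Proof. by rewrite /rlt => rs; apply: contra => tr; apply: rle_trans tr rs. Qed.

Lemma rlt_le_trans s r t : rlt r s -> rle s t -> rlt r t.
Proof. by rewrite /rlt => rs st; apply: contra rs; apply: rle_trans. Qed.

Lemma rlt_trans s r t : rlt r s -> rlt s t -> rlt r t.
Proof. by move=> rs /rltW; apply: rlt_le_trans. Qed.

Lemma rlt_irr r : ~ rlt r r.
Proof. by rewrite /rlt rle_refl. Qed.

Lemma rle_or_lt r s : rle r s \/ rlt s r.
Proof. by rewrite /rlt; case: (rle r s); [left|right]. Qed.

Lemma rltP r s : rlt r s -> ~ rle s r.
Proof. by move/negP. Qed.

Lemma rle_eqVlt r s : rle r s -> r = s \/ rlt r s.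
Proof.
move=> rs; case: (rle_or_lt s r) => [sr|]; [left; exact: rle_anti|by right].
Qed.

Lemma rlt_rpred s p r : rpred s = Some p -> rlt r s -> rle r p.
Proof. by case: s => [[|n]||] //= [<-]; case: r => [m||]; rewrite /rlt /=; lia. Qed.

Lemma rpred_inj r s p : rpred r = Some p -> rpred s = Some p -> r = s.
Proof. by case: r s => [[|n]||] [[|m]||] //= [<-] // [->]. Qed.

Lemma rlt_fin n r : rlt r (Fin n) -> natural_rank r.
Proof. by case: r => [m||] // _; exists m. Qed.

(** * The embracing relation *)

Section Embracing.
Variables (G : wdata) (nu : rank) (hG : is_wgraph G nu).
Implicit Types x y z u v X Y Z : G.

Lemma embraces_trans y x z : embraces x y -> embraces y z -> embraces x z.
Proof.
move=> xy; elim: xy z => [//|a b c ab _ IH z cz|a i c ra _ IH z cz].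
  exact: embraces_exc ab (IH _ cz).
exact: embraces_chain ra (IH _ cz).
Qed.

Lemma exc_vec x y : exc x = Some y -> rk x <> VecOmega.
Proof. by move=> xy /(wg_chain hG) [_]; rewrite xy. Qed.

Lemma chain_fin x i : rk x = VecOmega -> natural_rank (rk (chain x i)).
Proof. by move=> /(wg_chain hG) [[_ _ _ +] _]; apply. Qed.

Lemma chain_exc x i : rk x = VecOmega -> exc (chain x i.+1) = Some (chain x i).
Proof. by move=> /(wg_chain hG) [[_ + _ _] _]; apply. Qed.

Lemma chain_lt x i : rk x = VecOmega -> rlt (rk (chain x i)) (rk x).
Proof. by move=> h; case: (chain_fin i h) => n ->; rewrite h. Qed.

Lemma embraces_rank x y : embraces x y -> x = y \/ rlt (rk y) (rk x).
Proof.
elim=> [a|a b c ab _ IH|a i c ra _ IH]; first by left.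
  right; case: IH => [<-|h]; first exact: (wg_exc_rank hG).
  exact: rlt_trans h (wg_exc_rank hG ab).
right; case: IH => [<-|h]; first exact: chain_lt.
exact: rlt_trans h (chain_lt _ ra).
Qed.

Lemma embraces_le x y : embraces x y -> rle (rk y) (rk x).
Proof. by case/embraces_rank => [->|/rltW //]; apply: rle_refl. Qed.

Lemma embraces_eq x y : embraces x y -> rle (rk x) (rk y) -> x = y.
Proof. by case/embraces_rank => // /rltP. Qed.

Lemma chain_mono x i j : rk x = VecOmega -> (i <= j)%N ->
  embraces (chain x j) (chain x i).
Proof.
move=> rx /subnK <-; elim: (j - i)%N => [|n IH]; first exact: embraces_refl.
exact: embraces_exc (chain_exc (n + i) rx) IH.
Qed.

Lemma embraces_linear_fin X u v : natural_rank (rk X) ->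
  embraces X u -> embraces X v -> embraces u v \/ embraces v u.
Proof.
move=> + Xu; elim: Xu v => [a|a b c ab bc IH|a i c ra _ _] v nX av.
- by left.
- have nb : natural_rank (rk b).
    by case: nX => n ra; apply: (@rlt_fin n); rewrite -ra; exact: (wg_exc_rank hG ab).
  move: av; case Eav: _ _ / => [a'|a' b' c' ab' bc'|a' i c' ra' _].
  + by right; rewrite -Eav; exact: embraces_exc ab bc.
  + by move: ab'; rewrite -Eav ab => -[E]; apply: IH => //; rewrite E.
  + by case: (exc_vec ab); rewrite Eav.
- by case: nX => n; rewrite ra.
Qed.

Lemma embraces_inv x z : embraces x z ->
  [\/ x = z, exists2 y, exc x = Some y & embraces y z
   | exists2 i, rk x = VecOmega & embraces (chain x i) z].
Proof.
case=> [a|a b c ab bc|a i c ra h]; first by constructor 1.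
  by constructor 2; exists b.
by constructor 3; exists i.
Qed.

(** A wnode has at most one exceptional element, so descending from X never branches; for rank
    [VecOmega] the later of two chain members embraces both. *)
Lemma embraces_linear X u v :
  embraces X u -> embraces X v -> embraces u v \/ embraces v u.
Proof.
move=> Xu; elim: Xu v => [a|a b c ab bc IH|a i c ra ai _] v av.
- by left.
- case: (embraces_inv av) => [<-|[b']|[i ra _]].
  + by right; exact: embraces_exc ab bc.
  + by rewrite ab => -[<-]; apply: IH.
  + by case: (exc_vec ab).
- case: (embraces_inv av) => [<-|[b' ab' _]|[j _ aj]].
  + by right; exact: embraces_chain ra ai.
  + by case: (exc_vec ab').
  + have h := @chain_mono a _ _ ra.
    apply: (embraces_linear_fin (chain_fin (maxn i j) ra)).
      exact: embraces_trans (h _ _ (leq_maxl i j)) ai.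
    exact: embraces_trans (h _ _ (leq_maxr i j)) aj.
Qed.

Lemma embraces_cmp X u v : embraces X u -> embraces X v -> rle (rk v) (rk u) ->
  embraces u v.
Proof.
move=> Xu Xv uv; case: (embraces_linear Xu Xv) => // vu.
by rewrite (embraces_eq vu uv); apply: embraces_refl.
Qed.

(** The last step of the descent from Y to z starts at a wnode p whose exceptional element is z. By
    [wg_exc_uniq] this p depends on z alone, so that ascending does not branch either. *)
Lemma embraces_parent Y z : embraces Y z -> Y <> z ->
  exists2 p, exc p = Some z & embraces Y p.
Proof.
elim=> [//|a b c ab bc IH _|a i c ra ai IH _].
  have [bc'|bc'] := EM (b = c).
    by exists a; [rewrite -bc'|exact: embraces_refl].
  by case: (IH bc') => p pc bp; exists p => //; exact: embraces_exc ab bp.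
have [ic|ic] := EM (chain a i = c).
  exists (chain a i.+1); first by rewrite -ic; exact: chain_exc.
  exact: embraces_chain ra (embraces_refl _).
by case: (IH ic) => p pc bp; exists p => //; exact: embraces_chain ra bp.
Qed.

Definition comparable x y := embraces x y \/ embraces y x.

Lemma comparable_sym x y : comparable x y -> comparable y x.
Proof. by case; [right|left]. Qed.

Lemma exc_comparable X z Y : exc X = Some z -> comparable z Y -> comparable X Y.
Proof.
move=> Xz [zY|Yz]; first by left; exact: embraces_exc Xz zY.
have [Ez|Ez] := EM (Y = z).
  by left; apply: embraces_exc Xz _; rewrite Ez; exact: embraces_refl.
case: (embraces_parent Yz Ez) => p pz Yp.
by right; rewrite (wg_exc_uniq hG Xz pz).
Qed.

Lemma comparable_fin X Y y : natural_rank (rk X) -> embraces X y ->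
  embraces Y y -> comparable X Y.
Proof.
move=> + Xy; elim: Xy => [a|a b c ab bc IH|a i c ra _ _] nX Yy.
- by right.
- apply: (exc_comparable ab (IH _ Yy)).
  by case: nX => n ra; apply: (@rlt_fin n); rewrite -ra; exact: (wg_exc_rank hG ab).
- by case: nX => n; rewrite ra.
Qed.

Lemma exc_none_embraces x y : natural_rank (rk x) -> exc x = None ->
  embraces x y -> x = y.
Proof.
case=> n rx ex /embraces_inv [//|[z]|[i]]; first by rewrite ex.
by rewrite rx.
Qed.

Lemma chain_bottom Z u : rk Z = VecOmega -> natural_rank (rk u) ->
  embraces Z u -> embraces u (chain Z 0).
Proof.
move=> rZ nu_ Zu; have Z0 : embraces Z (chain Z 0).
  exact: embraces_chain rZ (embraces_refl _).
case: (embraces_linear Zu Z0) => // h0.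
rewrite -(@exc_none_embraces (chain Z 0) u (chain_fin 0 rZ) _ h0); first exact: embraces_refl.
by case: (wg_chain hG rZ) => -[].
Qed.

(** Both chains start at the wnode where the descent from y stops, and each wnode is exceptional in
    at most one other, so the chains agree member by member. *)
Lemma vec_inj X Y y : rk X = VecOmega -> rk Y = VecOmega ->
  natural_rank (rk y) -> embraces X y -> embraces Y y -> X = Y.
Proof.
move=> rX rY ny Xy Yy.
have X0 := chain_bottom rX ny Xy; have Y0 := chain_bottom rY ny Yy.
have E0 : chain X 0 = chain Y 0.
  case: (embraces_linear X0 Y0) => h.
    apply: exc_none_embraces h; first exact: chain_fin.
    by case: (wg_chain hG rX) => -[].
  symmetry; apply: exc_none_embraces h; first exact: chain_fin.
  by case: (wg_chain hG rY) => -[].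
have E : chain X = chain Y.
  apply: funext; elim=> [//|i IH].
  by apply: (wg_exc_uniq hG (chain_exc i rX)); rewrite IH; exact: chain_exc.
case: (wg_chain hG rX) => mX _; case: (wg_chain_uniq hG mX) => Z [_ U].
by rewrite -(U X) // -(U Y).
Qed.

Lemma comparable_le_vec X Y y : rle (rk X) VecOmega -> rle (rk Y) VecOmega ->
  embraces X y -> embraces Y y -> comparable X Y.
Proof.
move=> rX rY Xy Yy.
case EX : (rk X) rX => [n||//] _.
  by apply: (@comparable_fin X Y y) => //; exists n.
case EY : (rk Y) rY => [n||//] _.
  by apply/comparable_sym/(@comparable_fin Y X y) => //; exists n.
have [Ey|Ey] := EM (X = y); first by right; rewrite Ey.
have [Ey'|Ey'] := EM (Y = y); first by left; rewrite Ey'.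
have ny : natural_rank (rk y).
  case: (embraces_rank Xy) => // ; rewrite EX; case: (rk y) => //= k _.
  by exists k.
by left; rewrite (vec_inj EX EY ny Xy Yy); exact: embraces_refl.
Qed.

Lemma comparable_omega_le X Y y : rk Y = Omega -> rle (rk X) VecOmega ->
  embraces X y -> embraces Y y -> comparable X Y.
Proof.
move=> rY rX Xy Yy.
case: (embraces_inv Yy) => [Ey|[z Yz zy]|[i]]; last by rewrite rY.
  by left; rewrite Ey.
have rz : rle (rk z) VecOmega.
  by have := wg_exc_rank hG Yz; rewrite rY; case: (rk z).
exact/comparable_sym/(exc_comparable Yz)/(comparable_le_vec rz rX zy Xy).
Qed.

(** A wnode of natural rank is handled by induction on its descent to y, two wnodes of rank
    [VecOmega] by [vec_inj], and rank [Omega] by passing to the exceptional element. Uniqueness of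
    maximal wnodes rests on this. *)
Lemma comparable_up X Y y : embraces X y -> embraces Y y -> comparable X Y.
Proof.
move=> Xy Yy.
case EX : (rk X) => [n||].
- by apply: (@comparable_fin X Y y) => //; exists n.
- case EY : (rk Y) => [n||].
  + by apply: (comparable_le_vec (y := y)); rewrite ?EX ?EY.
  + by apply: (comparable_le_vec (y := y)); rewrite ?EX ?EY.
  + by apply: (comparable_omega_le (y := y)); rewrite ?EX ?EY.
- case EY : (rk Y) => [n||].
  + by apply/comparable_sym/(comparable_omega_le (y := y)); rewrite ?EX ?EY.
  + by apply/comparable_sym/(comparable_omega_le (y := y)); rewrite ?EX ?EY.
  + case: (embraces_inv Xy) => [Ey|[z Xz zy]|[i]]; last by rewrite EX.
      by right; rewrite Ey.
    apply: (exc_comparable Xz); apply: (comparable_omega_le (y := y)) => //.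
    by have := wg_exc_rank hG Xz; rewrite EX; case: (rk z).
Qed.

Lemma bottom_exists x : natural_rank (rk x) ->
  exists b, [/\ embraces x b, exc b = None & natural_rank (rk b)].
Proof.
case=> n; elim/ltn_ind: n x => n IH x rx.
case Ex : (exc x) => [z|]; last first.
  by exists x; split; [exact: embraces_refl| |exists n].
have := wg_exc_rank hG Ex; rewrite rx => h.
have [m rz] := rlt_fin h.
have lt : (m < n)%N by move: h; rewrite rz /rlt /= -ltnNge.
case: (IH m lt z rz) => b [zb eb nb]; exists b; split => //.
exact: embraces_exc Ex zb.
Qed.

(** * Existence of maximal wnodes *)

Section Maximal.
Variables (rho : rank) (S : wsubgraph G).
Hypothesis S_rank : forall x, snode S x -> rle (rk x) rho.
Hypothesis S_whole : natural_rank rho \/ rho = Omega /\ snode S = setT.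

(** Otherwise the ranks above x never stop growing. For natural rho this contradicts [S_rank]. For
    rho = [Omega], ascending from the bottom of x yields an infinite chain, and the [VecOmega]-wnode
    that it forms is incompatible with all ranks above x being natural. *)
Lemma maximal_exists x : snode S x ->
  exists X, maximal_node S X /\ embraces X x.
Proof.
move=> Sx; apply: contrapT => /forallNP noX.
have up Y : snode S Y -> embraces Y x ->
    exists Z, [/\ snode S Z, embraces Z Y & rlt (rk Y) (rk Z)].
  move=> SY Yx; apply: contrapT => /forallNP noZ; apply: (noX Y); split => //.
  by split => // Z SZ ZY YZ; apply: (noZ Z).
have unbounded n : exists Y, [/\ snode S Y, embraces Y x & rle (Fin n) (rk Y)].
  elim: n => [|n [Y [SY Yx nY]]].
    by exists x; split => //; [exact: embraces_refl|case: (rk x)].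
  case: (up Y SY Yx) => Z [SZ ZY YZ]; exists Z; split => //.
    exact: embraces_trans ZY Yx.
  move: (rle_lt_trans nY YZ); rewrite /rlt; case: (rk Z) => //= m; lia.
case: S_whole => [[n En]|[Erho Eset]].
  case: (unbounded n.+1) => Y [/S_rank]; rewrite En.
  by case: (rk Y) => //= m h1 _ h2; lia.
(* Two further strict steps upwards leave no room for [VecOmega] or [Omega]. *)
have nat_above Y : embraces Y x -> natural_rank (rk Y).
  move=> Yx; have SY : snode S Y by rewrite Eset.
  case: (up Y SY Yx) => Z [SZ ZY YZ].
  have [W [_ _ ZW]] := up Z SZ (embraces_trans ZY Yx).
  by move: YZ ZW; case: (rk Y) (rk Z) (rk W) => [a||] [b||] [c||] //; exists a.
have parent u : (exists2 Y, embraces Y x & embraces Y u) ->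
    exists p, exc p = Some u /\ exists2 Y, embraces Y x & embraces Y p.
  case=> Y Yx Yu; have [Z [_ ZY YZ]] : exists Z,
    [/\ snode S Z, embraces Z Y & rlt (rk Y) (rk Z)] by apply: up; rewrite ?Eset.
  have Zu : Z <> u.
    by move=> E; apply: (rltP YZ); rewrite E; exact: embraces_le.
  case: (embraces_parent (embraces_trans ZY Yu) Zu) => p pu Zp.
  by exists p; split=> //; exists Z => //; exact: embraces_trans ZY Yx.
have /choice [next nextP] : forall u, exists p,
    (exists2 Y, embraces Y x & embraces Y u) ->
    exc p = Some u /\ exists2 Y, embraces Y x & embraces Y p.
  move=> u; have [h|h] := EM (exists2 Y, embraces Y x & embraces Y u).
    by case: (parent u h) => p hp; exists p.
  by exists u.
have [b [xb eb nb]] := bottom_exists (nat_above x (embraces_refl x)).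
pose c n := iter n next b.
have cP n : exists2 Y, embraces Y x & embraces Y (c n).
  elim: n => [|n IH]; first by exists x => //; exact: embraces_refl.
  by case: (nextP _ IH).
have cexc n : exc (c n.+1) = Some (c n) by case: (nextP _ (cP n)).
have cmax : max_chain c.
  split => // n; first exact: (wg_exc_rank hG (cexc n)).
  case: (cP n) => Y /nat_above [m rY] /embraces_le; rewrite rY.
  by case: (rk (c n)) => // k _; exists k.
case: (wg_chain_uniq hG cmax) => V [[rV cV] _].
have Vb : embraces V b.
  by apply: (@embraces_chain G V 0) => //; rewrite cV; exact: embraces_refl.
case: (comparable_up Vb xb) => h.
  by have [n] := nat_above V h; rewrite rV.
have [n rx] := nat_above x (embraces_refl x).
by have := embraces_le h; rewrite rx rV.
Qed.

End Maximal.

Lemma maximal_unique S X Y y : maximal_node S X -> maximal_node S Y ->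
  embraces X y -> embraces Y y -> X = Y.
Proof.
move=> [SX mX] [SY mY] Xy Yy; case: (comparable_up Xy Yy) => h.
  by case: (embraces_rank h) => // /(mY _ SX h).
by case: (embraces_rank h) => // /(mX _ SY h).
Qed.

End Embracing.

(** * Ordinals *)

Section Ordinals.
Implicit Types (a b d : ord) (e f g : expo) (A : set ord).

Lemma nsumE a b e : nsum a b e = (a e + b e)%N.
Proof. by rewrite /nsum msetE2. Qed.

Lemma wpowE e k f : wpow e k f = if f == e then k else 0%N.
Proof. by rewrite /wpow msetnE. Qed.

Lemma expo_ltE e f : (e < f)%O = (e.1 < f.1)%N || (e.1 == f.1) && (e.2 < f.2)%N.
Proof. by rewrite Order.ProdLexiOrder.ltEprodlexi !leEnat ltEnat /=; lia. Qed.

Lemma expo_ind (P : expo -> Prop) :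
  (forall e, (forall f, (f < e)%O -> P f) -> P e) -> forall e, P e.
Proof.
move=> IH [i]; elim/ltn_ind: i => i IHi j; elim/ltn_ind: j => j IHj.
apply: IH => -[i' j']; rewrite expo_ltE /= => /orP [/IHi //|/andP [/eqP -> /IHj //]].
Qed.

Lemma ole_lt e a b : (a e < b e)%N -> (forall f, (e < f)%O -> a f = b f) ->
  ole a b.
Proof. by right; exists e. Qed.

Lemma seq_max (s : seq expo) (P : pred expo) : has P s ->
  exists f, [/\ f \in s, P f & forall g, g \in s -> P g -> (g <= f)%O].
Proof.
elim: s => //= x s IH; have [hs _|/hasPn hs] := boolP (has P s); last first.
  rewrite orbF => Px; exists x; split; rewrite ?mem_head // => g.
  by rewrite in_cons => /predU1P [-> //|/hs /negbTE ->].
case: (IH hs) => f [fs Pf fmax].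
have [Px|Px] := boolP (P x && (f <= x)%O).
  case/andP: Px => Px fx; exists x; split; rewrite ?mem_head // => g.
  rewrite in_cons => /predU1P [-> //|gs Pg]; exact: le_trans (fmax g gs Pg) fx.
exists f; split; rewrite ?in_cons ?fs ?orbT // => g.
move=> /predU1P [->|/fmax //] Px'.
by move: Px; rewrite Px' /= -ltNge => /ltW.
Qed.

Lemma support_max a (D : set expo) e : D e -> (0 < a e)%N ->
  exists f, [/\ D f, (0 < a f)%N, (e <= f)%O &
                forall g, D g -> (f < g)%O -> a g = 0%N].
Proof.
move=> De ae; have [|f [fa /asboolP Df fmax]] := @seq_max (finsupp a) (fun f => `[< D f >]).
  by apply/hasP; exists e; [rewrite msuppE in_mset|exact/asboolP].
exists f; split => //; first by rewrite -in_mset -msuppE.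
  by apply: fmax; [rewrite msuppE in_mset|exact/asboolP].
move=> g Dg fg; apply/eqP; rewrite mset_eq0; apply: contraTN fg => ga.
by rewrite -leNgt; apply: fmax; [rewrite msuppE|exact/asboolP].
Qed.

Lemma nat_set_min (A : set nat) : A !=set0 ->
  exists2 k, A k & forall n, A n -> (k <= n)%N.
Proof.
move=> [n An]; have ex : exists n, `[< A n >] by exists n; exact/asboolP.
case: (ex_minnP ex) => k /asboolP Ak kmin; exists k => // m Am.
exact/kmin/asboolP.
Qed.

(** The well-ordering relative to D: members of A may differ only at exponents in D. This allows an
    induction in which D shrinks to the exponents below a leading one. *)
Definition has_min_on (D : set expo) := forall A, A !=set0 ->
  (forall a b e, A a -> A b -> ~ D e -> a e = b e) ->
  exists2 d, A d & forall b, A b -> ole d b.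

(** Let f be the leading exponent within D of some member of A. The minimum is sought among the
    members that vanish in D above f and have the least coefficient at f; these differ only below f.
    Every other member is larger at f or has a larger leading exponent. *)
Lemma has_min_on_step (D : set expo) :
  (forall f, D f -> has_min_on [set g | D g /\ (g < f)%O]) -> has_min_on D.
Proof.
move=> IH A [a Aa] agree.
have [[e [De ae]]|a0] := EM (exists e, D e /\ (0 < a e)%N); last first.
  exists a => // b Ab; have [[e [De be]]|b0] := EM (exists e, D e /\ (0 < b e)%N).
    case: (support_max De be) => f [Df bf _ fmax].
    have az g : D g -> a g = 0%N.
      move=> Dg; apply/eqP; rewrite -leqn0 leqNgt; apply/negP => ag.
      by apply: a0; exists g.
    apply: (@ole_lt f); first by rewrite az.
    move=> g fg; have [Dg|Dg] := EM (D g); last exact: agree.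
    by rewrite az // fmax.
  left; apply/msetP => g; have [Dg|Dg] := EM (D g); last exact: agree.
  have z c : ~ (exists e, D e /\ (0 < c e)%N) -> c g = 0%N.
    move=> c0; apply/eqP; rewrite -leqn0 leqNgt; apply/negP => cg.
    by apply: c0; exists g.
  by rewrite !z.
case: (support_max De ae) => f [Df _ _ fmax].
pose low b := forall g, D g -> (f < g)%O -> b g = 0%N.
have [|k [a' [[Aa' la'] <-]] kmin] := @nat_set_min [set k | exists b, (A b /\ low b) /\ b f = k].
  by exists (a f), a.
have [||d [Ad ld df] dmin] := IH f Df [set b | [/\ A b, low b & b f = a' f]].
- by exists a'.
- move=> b c g [Ab lb bf] [Ac lc cf] Dg.
  have [Dg'|Dg'] := EM (D g); last exact: agree.
  case: (ltgtP g f) => [gf|fg|->]; [by case: Dg|by rewrite lb ?lc|by rewrite bf cf].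
exists d => // b Ab; have [lb|lb] := EM (low b).
  have [bf|bf] := EM (b f = a' f); first exact: dmin.
  apply: (@ole_lt f).
    by rewrite df; have := kmin _ (ex_intro _ b (conj (conj Ab lb) erefl)); lia.
  move=> g fg; have [Dg|Dg] := EM (D g); last exact: agree.
  by rewrite ld ?lb.
have [g [[Dg fg] bg]] : exists g, (D g /\ (f < g)%O) /\ (0 < b g)%N.
  apply: contrapT => h; apply: lb => g Dg fg; apply/eqP; rewrite -leqn0 leqNgt.
  by apply/negP => bg; apply: h; exists g.
have [h [[Dh fh] bh _ hmax]] := @support_max b [set g | D g /\ (f < g)%O] g (conj Dg fg) bg.
apply: (@ole_lt h); first by rewrite ld.
move=> i hi; have [Di|Di] := EM (D i); last exact: agree.
have fi := lt_trans fh hi; by rewrite ld // hmax.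
Qed.

Lemma ord_min A : A !=set0 -> exists2 d, A d & forall b, A b -> ole d b.
Proof.
have below f : has_min_on [set g | (g < f)%O].
  elim/expo_ind: f => f IH; apply: has_min_on_step => g /= gf.
  have -> : [set h : expo | (h < f)%O /\ (h < g)%O] = [set h | (h < g)%O].
    by apply/seteqP; split => h /= => [[]//|hg]; split => //; exact: lt_trans hg gf.
  exact: IH.
move=> A0; have : has_min_on setT.
  apply: has_min_on_step => f _.
  have -> : [set g : expo | True /\ (g < f)%O] = [set g | (g < f)%O].
    by apply/seteqP; split => h /= => [[]//|].
  exact: below.
by move=> h; apply: h => // a b e _ _ [].
Qed.

Definition bounded e a := forall f, (e < f)%O -> a f = 0%N.

Lemma ole_lead e a b : bounded e a -> bounded e b -> ole a b -> (a e <= b e)%N.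
Proof.
move=> ea eb [-> //|[f [fab above]]].
case: (ltgtP f e) => [fe|ef|E]; first by rewrite above.
  by rewrite (ea f ef) (eb f ef) in fab.
by rewrite -E; exact: ltnW.
Qed.

(** The inequality is strict because equal coefficients at e would leave the decision to smaller
    exponents. *)
Lemma lead_ole e a b : bounded e a -> bounded e b -> (a e < b e)%N -> ole a b.
Proof. by move=> ea eb ab; apply: (ole_lt ab) => f ef; rewrite ea ?eb. Qed.

End Ordinals.

(** * Walks *)

Section IndexRanges.
Local Open Scope ring_scope.
Implicit Types (lo hi : option int) (m k : int).

Definition lohi lo hi : Prop := if (lo, hi) is (Some a, Some b) then a <= b else True.

Lemma in_piecesE lo hi m : in_pieces lo hi m = in_nodes lo hi m && in_nodes lo hi (m + 1).
Proof. by case: lo hi => [a|] [b|]; rewrite /in_pieces /in_nodes /=; lia. Qed.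

Lemma nonterminalE lo hi m :
  nonterminal lo hi m = in_nodes lo hi (m - 1) && in_nodes lo hi (m + 1).
Proof. by case: lo hi => [a|] [b|]; rewrite /nonterminal /in_nodes /=; lia. Qed.

Lemma in_nodes_opp lo hi m : in_nodes (omap -%R hi) (omap -%R lo) m = in_nodes lo hi (- m).
Proof. by case: lo hi => [a|] [b|]; rewrite /in_nodes /=; lia. Qed.

Lemma lohi_opp lo hi : lohi lo hi -> lohi (omap -%R hi) (omap -%R lo).
Proof. by case: lo hi => [a|] [b|] //=; rewrite /lohi; lia. Qed.

End IndexRanges.

(** * Reversal of walks, and coefficients of lengths *)

Section Reversal.
Local Open Scope ring_scope.
Variable X : Type.
Implicit Type w : prewalk X.

Lemma rev_walkK w : rev_walk (rev_walk w) = w.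
Proof.
elim: w => //= r lo hi x W IH; congr Walk.
- by case: lo => //= a; rewrite opprK.
- by case: hi => //= a; rewrite opprK.
- by apply: funext => m; rewrite opprK.
- apply: funext => m; rewrite -[RHS]IH; congr (rev_walk (rev_walk (W _))); lia.
Qed.

Lemma walk_rank_rev w : walk_rank (rev_walk w) = walk_rank w.
Proof. by case: w. Qed.

Lemma right_infinite_rev w : right_infinite (rev_walk w) = left_infinite w.
Proof. by case: w => //= r [a|] hi x W. Qed.

Lemma left_infinite_rev w : left_infinite (rev_walk w) = right_infinite w.
Proof. by case: w => //= r lo [a|] x W. Qed.

Lemma nontrivial_rev w : nontrivial w -> nontrivial (rev_walk w).
Proof.
case: w => //= r lo hi x W [m]; rewrite in_piecesE => /andP [h1 h2].
exists (- m - 1); rewrite in_piecesE !in_nodes_opp; apply/andP; split.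
  by move: h2; congr (is_true (in_nodes _ _ _)); lia.
by move: h1; congr (is_true (in_nodes _ _ _)); lia.
Qed.

Lemma walk_in_rev (P : set X) B w : (forall x y, B x y -> B y x) ->
  walk_in P B w -> walk_in P B (rev_walk w).
Proof.
move=> symB; elim: w => [a b|r lo hi x W IH] /=; first exact: symB.
case=> hx hW; split=> m.
  by rewrite in_nodes_opp => /hx.
rewrite in_piecesE !in_nodes_opp => /andP [h1 h2]; apply/IH/hW.
rewrite in_piecesE; apply/andP; split.
  by move: h2; congr (is_true (in_nodes _ _ _)); lia.
by move: h1; congr (is_true (in_nodes _ _ _)); lia.
Qed.

Lemma big_nsumE n (F : 'I_n -> ord) (e : expo) :
  (\big[nsum/mset0%mset]_(i < n) F i) e = (\sum_(i < n) F i e)%N.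
Proof.
elim: n F => [|n IH] F; first by rewrite !big_ord0 mset0E.
by rewrite !big_ord_recl nsumE IH.
Qed.

(** Lengths are handled one coefficient at a time, which turns natural sums of ordinals into sums of
    natural numbers. *)
Definition piece_sum (W : int -> prewalk X) (a : int) n (e : expo) : nat :=
  (\sum_(i < n) walk_length (W (a + i%:Z)%R) e)%N.

Lemma walk_length_two r a b x W (e : expo) :
  walk_length (Walk r (Some a) (Some b) x W) e = piece_sum W a `|b - a|%N e.
Proof. exact: big_nsumE. Qed.

Lemma piece_sumD W a n n' e :
  piece_sum W a (n + n')%N e = (piece_sum W a n e + piece_sum W (a + n%:Z)%R n' e)%N.
Proof.
rewrite /piece_sum big_split_ord /=; congr addn.
by apply: eq_bigr => i _; congr (walk_length (W _) e); lia.
Qed.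

Lemma piece_sum_eq W W' a a' n e :
  (forall i, (i < n)%N -> W (a + i%:Z) = W' (a' + i%:Z)) ->
  piece_sum W a n e = piece_sum W' a' n e.
Proof. by move=> h; apply: eq_bigr => i _; rewrite h. Qed.

Lemma piece_sum1 W a e : piece_sum W a 1 e = walk_length (W a) e.
Proof. by rewrite /piece_sum big_ord1 /= addr0. Qed.

End Reversal.

(** * The walk conditions, rank by rank, and their symmetry under reversal *)

Section Walks.
Local Open Scope ring_scope.
Variable G : wdata.
Implicit Types (x y : int -> G) (u v e : G) (w : prewalk G) (W Z : int -> prewalk G).
Implicit Types (lo hi : option int) (r p : rank).

Definition piece_ok r x W (m : int) : Prop :=
  [/\ is_walk (W m), nontrivial (W m), rlt (walk_rank (W m)) r,
      reaches_left (W m) (x m) & reaches_right (W m) (x (m + 1))].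

Definition junction_ok p x W (m : int) : Prop :=
  reaches_right_by p (W (m - 1)) (x m) \/ reaches_left_by p (W m) (x m).

(** The ranks with a predecessor are the positive natural numbers and [Omega]; stating the
    conditions through p treats them together. *)
Lemma is_walk_reg r p lo hi x W : rpred r = Some p ->
  is_walk (Walk r lo hi x W) <->
  [/\ lohi lo hi, (forall m, in_nodes lo hi m -> rle (rk (x m)) r),
      (forall m, nonterminal lo hi m -> rk (x m) = r),
      (forall m, in_pieces lo hi m -> piece_ok r x W m)
    & (forall m, nonterminal lo hi m -> junction_ok p x W m)].
Proof.
move=> rp; have E : is_walk (Walk r lo hi x W) <-> lohi lo hi /\
  [/\ (forall m, in_nodes lo hi m -> rle (rk (x m)) r),
      (forall m, nonterminal lo hi m -> rk (x m) = r),
      (forall m, in_pieces lo hi m -> piece_ok r x W m)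
    & (forall m, nonterminal lo hi m -> exists2 p, rpred r = Some p & junction_ok p x W m)].
  by case: r rp => [[|n]||].
rewrite E; split=> [[h [h1 h2 h3 h4]]|[h h1 h2 h3 h4]].
  by split => // m /h4 [q]; rewrite rp => -[<-].
by split => //; split => // m /h4; exists p.
Qed.

Definition climbs (x : G) (w : prewalk G) (y : G) : Prop :=
  [/\ rlt (rk x) (rk y), rlt (walk_rank w) (rk y)
    & exists2 p, rpred (rk y) = Some p & reaches_right_by p w y].

Definition descends (x : G) (w : prewalk G) (y : G) : Prop :=
  [/\ rlt (rk y) (rk x), rlt (walk_rank w) (rk x)
    & exists2 p, rpred (rk x) = Some p & reaches_left_by p w x].

Definition vec_piece (c : int) x W m : Prop :=
  [/\ is_walk (W m), nontrivial (W m), reaches_left (W m) (x m),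
      reaches_right (W m) (x (m + 1))
    & if c <= m then climbs (x m) (W m) (x (m + 1))
      else descends (x m) (W m) (x (m + 1))].

Definition vec_ends (c : int) lo hi : Prop :=
  [/\ (if lo is Some a then c = a else True),
      (if hi is Some b then c = b else True) & lo = None \/ hi = None].

Definition vec_walk (c : int) lo hi x W : Prop :=
  [/\ vec_ends c lo hi,
      (forall m, in_nodes lo hi m -> natural_rank (rk (x m)))
    & forall m, in_pieces lo hi m -> vec_piece c x W m].

Lemma is_walk_vec lo hi x W :
  is_walk (Walk VecOmega lo hi x W) <-> exists c, vec_walk c lo hi x W.
Proof.
split=> [[_ [c [h1 h2 h3 h4 h5]]]|[c [[h1 h2 h3] h4 h5]]]; first by exists c.
split; first by case: h3 => ->; case: lo {h1 h2 h4 h5}.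
by exists c.
Qed.

Lemma is_walk_0 lo hi x W :
  is_walk (Walk (Fin 0) lo hi x W) <->
  [/\ lohi lo hi, (forall m, in_nodes lo hi m -> rk (x m) = Fin 0)
    & (forall m, in_pieces lo hi m ->
        W m = Branch (x m) (x (m + 1)) /\ adj (x m) (x (m + 1)))].
Proof. by split=> [[h [h1 h2]]|[h h1 h2]]. Qed.

Lemma is_walk_lohi r lo hi x W : is_walk (Walk r lo hi x W) -> lohi lo hi.
Proof. by case. Qed.

Lemma piece_walk r lo hi x W m : is_walk (Walk r lo hi x W) ->
  in_pieces lo hi m -> (exists a b, W m = Branch a b) \/ is_walk (W m).
Proof.
case: r => [[|n]||].
- by move=> /is_walk_0 [_ _ h] /h [-> _]; left; exists (x m), (x (m + 1)).
- by move/(@is_walk_reg _ (Fin n)) => /(_ erefl) [_ _ _ h _] /h []; right.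
- by move/is_walk_vec => [c [_ _ h]] /h []; right.
- by move/(@is_walk_reg _ VecOmega) => /(_ erefl) [_ _ _ h _] /h []; right.
Qed.

(** For a term that is not a walk the index range may be reversed, with a > b, and then the two sums
    run over different pieces. *)
Lemma walk_length_rev w (f : expo) : is_walk w ->
  walk_length (rev_walk w) f = walk_length w f.
Proof.
elim: w => // r lo hi x W IH.
case: lo hi => [a|] [b|] // ww; rewrite [rev_walk _]/= !walk_length_two.
have ab := is_walk_lohi ww.
have -> : `|- a - - b|%N = `|b - a|%N by lia.
rewrite /piece_sum (reindex_inj rev_ord_inj) /=; apply: eq_bigr => i _.
have := ltn_ord i; move: (nat_of_ord i) => j jlt.
have -> : (- (- b + (`|b - a| - j.+1)%:Z) - 1)%R = a + j%:Z by move: ab; rewrite /lohi; lia.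
have : in_pieces (Some a) (Some b) (a + j%:Z).
  by rewrite /in_pieces /=; move: ab; rewrite /lohi; lia.
by move/(piece_walk ww) => [[u [v ->]]|/IH].
Qed.

Lemma reaches_left_rev w u : reaches_left (rev_walk w) u = reaches_right w u.
Proof. by rewrite /reaches_left rev_walkK. Qed.

Lemma reaches_right_rev w u : reaches_right (rev_walk w) u = reaches_left w u.
Proof. by []. Qed.

Lemma reaches_left_by_rev r w u : reaches_left_by r (rev_walk w) u = reaches_right_by r w u.
Proof. by rewrite /reaches_left_by left_infinite_rev walk_rank_rev reaches_left_rev. Qed.

Lemma reaches_right_by_rev r w u : reaches_right_by r (rev_walk w) u = reaches_left_by r w u.
Proof. by rewrite /reaches_right_by right_infinite_rev walk_rank_rev. Qed.

Lemma is_walk_rev (adjC : forall u v : G, adj u v -> adj v u) w :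
  is_walk w -> is_walk (rev_walk w).
Proof.
elim: w => // r lo hi x W IH.
have pieces m : in_pieces (omap -%R hi) (omap -%R lo) m = in_pieces lo hi (- m - 1).
  by rewrite !in_piecesE !in_nodes_opp andbC; congr (_ && _); congr in_nodes; lia.
have nonterm m : nonterminal (omap -%R hi) (omap -%R lo) m = nonterminal lo hi (- m).
  by rewrite !nonterminalE !in_nodes_opp andbC; congr (_ && _); congr in_nodes; lia.
have E m : - (m + 1) = - m - 1 :> int by lia.
have E' m : - m - 1 + 1 = - m :> int by lia.
have reg p : rpred r = Some p -> is_walk (Walk r lo hi x W) -> is_walk (rev_walk (Walk r lo hi x W)).
  move=> rp /(is_walk_reg _ _ _ _ rp) [h0 h1 h2 h3 h4].
  apply/(is_walk_reg _ _ _ _ rp); split.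
  - exact: lohi_opp.
  - by move=> m; rewrite in_nodes_opp => /h1.
  - by move=> m; rewrite nonterm => /h2.
  - move=> m; rewrite pieces => /h3 [g1 g2 g3 g4 g5]; split.
    + exact: IH.
    + exact: nontrivial_rev.
    + by rewrite walk_rank_rev.
    + by rewrite reaches_left_rev; rewrite E' in g5.
    + by rewrite reaches_right_rev E.
  - move=> m; rewrite nonterm => /h4 [h|h]; [right|left].
      by rewrite reaches_left_by_rev.
    rewrite reaches_right_by_rev.
    by have -> : - (m - 1) - 1 = - m :> int by lia.
case: r reg => [[|n]||] reg; [|exact: (reg (Fin n))| |exact: (reg VecOmega)].
- move=> /is_walk_0 [h0 h1 h2]; apply/is_walk_0; split.
  + exact: lohi_opp.
  + by move=> m; rewrite in_nodes_opp => /h1.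
  + move=> m; rewrite pieces => /h2 [-> /adjC]; rewrite /= E' E.
    by [].
- move/is_walk_vec => [c [[h1 h2 h3] h4 h5]]; apply/is_walk_vec; exists (- c); split.
  + split; [by case: hi h2 {h3 h4 h5 pieces nonterm IH reg} => //= b ->|
      by case: lo h1 {h3 h4 h5 pieces nonterm IH reg} => //= b ->|].
    by case: h3 => ->; [right|left].
  + by move=> m; rewrite in_nodes_opp => /h4.
  + move=> m; rewrite pieces => /h5 [g1 g2 g3 g4 g5]; split.
    * exact: IH.
    * exact: nontrivial_rev.
    * by rewrite reaches_left_rev; rewrite E' in g4.
    * by rewrite reaches_right_rev E.
    * move: g5; rewrite E' E.
      have -> : (- c <= m) = ~~ (c <= - m - 1) by lia.
      case: (c <= _) => -[k1 k2 [p k3 k4]]; split; rewrite ?walk_rank_rev //; exists p => //.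
        by rewrite reaches_left_by_rev.
      by rewrite reaches_right_by_rev.
Qed.

End Walks.

(** * Parts of walks *)

Section SubWalks.
Local Open Scope ring_scope.
Variable G : wdata.
Implicit Types (x y : int -> G) (u v e : G) (w : prewalk G) (W Z : int -> prewalk G).
Implicit Types (lo hi : option int) (r p : rank).

(* (lo', hi', x', W') is the part between lo' and hi' of (lo, hi, x, W),
   reindexed by k. *)
Definition part_of (k : int) lo hi x W lo' hi' x' W' : Prop :=
  [/\ (forall m, in_nodes lo' hi' m -> in_nodes lo hi (m + k)),
      (forall m, in_nodes lo' hi' m -> x' m = x (m + k))
    & (forall m, in_pieces lo' hi' m -> W' m = W (m + k))].

Lemma part_pieces k lo hi x W lo' hi' x' W' m :
  part_of k lo hi x W lo' hi' x' W' ->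
  in_pieces lo' hi' m -> in_pieces lo hi (m + k).
Proof.
case=> h _ _; rewrite !in_piecesE => /andP [/h -> /h].
by rewrite -addrA (addrC 1) addrA.
Qed.

Lemma part_nonterminal k lo hi x W lo' hi' x' W' m :
  part_of k lo hi x W lo' hi' x' W' ->
  nonterminal lo' hi' m -> nonterminal lo hi (m + k).
Proof.
case=> h _ _; rewrite !nonterminalE => /andP [/h h1 /h h2].
by rewrite (addrAC m k) h1 (addrAC m k).
Qed.

Lemma nonterminal_nodes lo hi m : nonterminal lo hi m ->
  [/\ in_nodes lo hi m, in_pieces lo hi (m - 1) & in_pieces lo hi m].
Proof.
by case: lo hi => [a|] [b|]; rewrite /nonterminal /in_nodes /in_pieces /= => h; split; lia.
Qed.

Lemma pieces_nodes lo hi m : in_pieces lo hi m ->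
  in_nodes lo hi m /\ in_nodes lo hi (m + 1).
Proof. by rewrite in_piecesE => /andP. Qed.

Lemma part_is_walk k r lo hi x W lo' hi' x' W' : r <> VecOmega ->
  lohi lo' hi' -> part_of k lo hi x W lo' hi' x' W' ->
  is_walk (Walk r lo hi x W) -> is_walk (Walk r lo' hi' x' W').
Proof.
move=> rV lh sub; have [hn hx hW] := sub.
have E m : m + 1 + k = m + k + 1 :> int by lia.
have E' m : m - 1 + k = m + k - 1 :> int by lia.
have reg p : rpred r = Some p -> is_walk (Walk r lo hi x W) -> is_walk (Walk r lo' hi' x' W').
  move=> rp /(is_walk_reg _ _ _ _ rp) [h0 h1 h2 h3 h4].
  apply/(is_walk_reg _ _ _ _ rp); split => // m.
  - by move=> mn; rewrite hx //; apply/h1/hn.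
  - move=> mn; have [mn' _ _] := nonterminal_nodes mn.
    by rewrite hx //; apply/h2/(part_nonterminal sub).
  - move=> mp; have [m1 m2] := pieces_nodes mp.
    by rewrite /piece_ok hW // !hx // E; apply/h3/(part_pieces sub).
  - move=> mn; have [mn' mp1 mp2] := nonterminal_nodes mn.
    by rewrite /junction_ok !hW // hx // E'; apply/h4/(part_nonterminal sub).
case: r rV reg => [[|n]||] // rV reg; [|exact: (reg (Fin n))|exact: (reg VecOmega)].
move=> /is_walk_0 [h0 h1 h2]; apply/is_walk_0; split => // m mp.
  by rewrite hx //; apply/h1/hn.
have [m1 m2] := pieces_nodes mp.
by rewrite hW // !hx // E; apply/h2/(part_pieces sub).
Qed.

(** Rank [VecOmega] is separate because a part may need a new turning index c': this must be the
    terminal index of the part if there is one, and each piece must keep its direction. *)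
Lemma part_vec_walk k c c' lo hi x W lo' hi' x' W' :
  vec_ends c' lo' hi' -> part_of k lo hi x W lo' hi' x' W' ->
  (forall m, in_pieces lo' hi' m -> (c' <= m) = (c <= m + k)) ->
  vec_walk c lo hi x W -> vec_walk c' lo' hi' x' W'.
Proof.
move=> ends sub hc; have [hn hx hW] := sub.
have E m : m + 1 + k = m + k + 1 :> int by lia.
move=> [_ h1 h2]; split => // m mp.
  by rewrite hx //; apply/h1/hn.
have [m1 m2] := pieces_nodes mp.
by rewrite /vec_piece hc // hW // !hx // E; apply/h2/(part_pieces sub).
Qed.

Lemma part_walk_in k r lo hi x W lo' hi' x' W' P B :
  part_of k lo hi x W lo' hi' x' W' ->
  walk_in P B (Walk r lo hi x W) -> walk_in P B (Walk r lo' hi' x' W').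
Proof.
move=> sub [h1 h2]; have [hn hx hW] := sub; split => m mp.
  by rewrite hx //; apply/h1/hn.
by rewrite hW //; apply/h2/(part_pieces sub).
Qed.

Lemma part_cut lo hi lo' hi' x W :
  (forall m, in_nodes lo' hi' m -> in_nodes lo hi m) ->
  part_of 0 lo hi x W lo' hi' x W.
Proof. by move=> h; split=> m; rewrite addr0 //; exact: h. Qed.

End SubWalks.

(** * Positions in the unbracketed sequence of a walk *)

Section Positions.
Local Open Scope ring_scope.
Variable G : wdata.
Implicit Types (m k : int) (b : bool) (s p q : position).

Lemma position_lt_cons m b s m' b' s' :
  (((m, b) :: s : position) < ((m', b') :: s' : position))%O =
  [|| m < m', (m == m') && ~~ b && b' | (m == m') && (b == b') && (s < s' :> position)%O].
Proof.
rewrite Order.SeqLexiOrder.ltxi_cons !Order.ProdLexiOrder.leEprodlexi.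
case: (ltgtP m m') => h //=.
all: by case: b b' => [] [] //=.
Qed.

Definition shift_position k p : position :=
  if p is (m, b) :: s then (m - k, b) :: s else [::].

Lemma shift_positionK k p : shift_position (- k) (shift_position k p) = p.
Proof. by case: p => // -[m b] s /=; congr ((_, _) :: _); lia. Qed.

Lemma shift_position_lt k p q :
  (shift_position k p < shift_position k q :> position)%O = (p < q)%O.
Proof.
case: p q => [|[m b] s] [|[m' b'] s'] //=; rewrite !position_lt_cons.
by have [-> ->] : (m - k < m' - k) = (m < m') /\ (m - k == m' - k) = (m == m') by lia.
Qed.

Lemma entry_shift r lo hi (x : int -> G) W r' lo' hi' (x' : int -> G) W' k m b s l :
  (forall i, nonterminal lo hi i -> m <= i -> nonterminal lo' hi' (i - k) /\ x i = x' (i - k)) ->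
  (forall i, in_pieces lo hi i -> m <= i -> in_pieces lo' hi' (i - k) /\ W i = W' (i - k)) ->
  forall i, m <= i -> entry (Walk r lo hi x W) ((i, b) :: s) l ->
  entry (Walk r' lo' hi' x' W') ((i - k, b) :: s) l.
Proof.
move=> hx hW i mi H; inversion H; subst.
  by case: (hx i) => // h ->; apply: entry_node.
by case: (hW i) => // h E; apply: entry_piece => //; rewrite -E.
Qed.

Lemma entry_cons r lo hi (x : int -> G) W p l :
  entry (Walk r lo hi x W) p l -> exists m b s, p = (m, b) :: s.
Proof. by move=> H; inversion H; subst; [exists m, false, [::]|exists m, true, p0]. Qed.

End Positions.

(** * Ends of walks and their dependence on far tails *)

Section Ends.
Local Open Scope ring_scope.
Variables (G : wdata) (nu : rank) (hG : is_wgraph G nu).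
Implicit Types (x y : int -> G) (u v e : G) (w : prewalk G) (W Z : int -> prewalk G).
Implicit Types (lo hi : option int) (r p : rank) (k m : int).

(* The wnode at which w terminates or whose element is the wtip of w. *)
Definition end_right w e : Prop :=
  match w with
  | Branch _ _ => False
  | Walk _ _ (Some j) x _ => x j = e
  | Walk _ lo None _ _ => exists m t, [/\ ge_lo lo m, tips e t & t (tail m w)]
  end.

Definition end_left w e : Prop := end_right (rev_walk w) e.

(** Separates the wnode determined by the walk from the wnodes that embrace it, so that either can
    be changed without the other. *)
Lemma reaches_rightE w u :
  reaches_right w u <-> exists2 e, embraces u e & end_right w e.
Proof.
case: w => [a b|r lo [j|] x W] /=.
- by split => // -[].
- by split=> [h|[e h ->] //]; exists (x j).
- split=> [[m [t [h1 [e h2 h3] h4]]]|[e h [m [t [h1 h2 h3]]]]].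
    by exists e => //; exists m, t.
  by exists m, t; split => //; exists e.
Qed.

Lemma reaches_leftE w u :
  reaches_left w u <-> exists2 e, embraces u e & end_left w e.
Proof. exact: reaches_rightE. Qed.

Lemma reaches_right_trans w u v :
  reaches_right w v -> embraces u v -> reaches_right w u.
Proof.
move=> /reaches_rightE [e ve we] uv; apply/reaches_rightE; exists e => //.
exact: embraces_trans uv ve.
Qed.

Lemma reaches_left_trans w u v :
  reaches_left w v -> embraces u v -> reaches_left w u.
Proof. exact: reaches_right_trans. Qed.

Lemma tips_wtip e t : tips e t -> exists2 r, rpred (rk e) = Some r & is_wtip r t.
Proof.
move=> et; case E : (rpred (rk e)) => [r|].
  by exists r => //; case: (wg_tips hG E) => _; apply.
by move: et; rewrite (wg_tips_none hG E).
Qed.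

Lemma end_right_infinite w e : right_infinite w -> end_right w e ->
  rpred (rk e) = Some (walk_rank w).
Proof.
case: w => // r lo [//|] x W _ [m [t [_ /tips_wtip [r' -> [w0 _ ->]] [[_ <-]]]]].
by [].
Qed.

Lemma end_left_infinite w e : left_infinite w -> end_left w e ->
  rpred (rk e) = Some (walk_rank w).
Proof.
by rewrite -right_infinite_rev -walk_rank_rev; apply: end_right_infinite.
Qed.

Lemma walk_node_rank r lo hi x W m : is_walk (Walk r lo hi x W) ->
  in_nodes lo hi m -> rle (rk (x m)) r.
Proof.
case: r => [[|n]||].
- by move=> /is_walk_0 [_ h _] /h ->.
- by move/(@is_walk_reg _ _ (Fin n)) => /(_ erefl) [_ h _ _ _] /h.
- by move/is_walk_vec => [c [_ h _]] /h [n ->].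
- by move/(@is_walk_reg _ _ VecOmega) => /(_ erefl) [_ h _ _ _] /h.
Qed.

Lemma last_node lo j : lohi lo (Some j) -> in_nodes lo (Some j) j.
Proof. by case: lo => [a|]; rewrite /in_nodes /= ?lexx ?andbT. Qed.

Lemma first_node j hi : lohi (Some j) hi -> in_nodes (Some j) hi j.
Proof. by case: hi => [a|]; rewrite /in_nodes /= lexx. Qed.

Lemma end_right_rank w e : is_walk w -> ~ right_infinite w -> end_right w e ->
  rle (rk e) (walk_rank w).
Proof.
case: w => // r lo [j|] x W; last by move=> _ /(_ I).
by move=> ww _ /= <-; apply: (walk_node_rank ww); apply/last_node/(is_walk_lohi ww).
Qed.

(** A wtip belongs to a wnode one rank above its walk, a terminal wnode never exceeds the rank of
    the walk. *)
Lemma end_right_lt s w e : is_walk w -> rlt (walk_rank w) s -> end_right w e ->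
  rle (rk e) s.
Proof.
move=> ww ws we; have [inf|fin] := EM (right_infinite w).
  move: ws; have := end_right_infinite inf we.
  by case: (rk e) => [[|n]||] //= [<-]; case: s => [m||]; rewrite /rlt /=; lia.
exact: rle_trans (end_right_rank ww fin we) (rltW ws).
Qed.

Lemma same_walk_inv r lo hi x W r' lo' hi' x' W' :
  same_walk (Walk r lo hi x W) (Walk r' lo' hi' x' W') ->
  exists k, [/\ lo' = omap (+%R k) lo, hi' = omap (+%R k) hi,
    (forall m, in_nodes lo hi m -> x m = x' (k + m))
  & (forall m, in_pieces lo hi m -> same_walk (W m) (W' (k + m)))].
Proof. by move=> H; inversion H; subst; exists k. Qed.

Lemma same_tip_far r w0 lo x W lo' x' W' k M m : r <> VecOmega ->
  (forall i, M <= i -> x' i = x (i + k) /\ W' i = W (i + k)) ->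
  eventually_identical w0 (Walk r (Some m) None x W) ->
  exists N, forall m2, N <= m2 -> 
    eventually_identical w0 (Walk r (Some m2) None x' W').
Proof.
move=> _ far [n [n' [h1 h2 H]]].
case: w0 h1 H => [u v //|r0 lo0 hi0 x0 W0] h1 /same_walk_inv [k0 [[En'] Ehi Hx HW]].
have {}Ehi : hi0 = None by case: hi0 Ehi {h1 Hx HW}.
(* In the indices of x', the agreement with x starts at M and the identification with w0 at k0 + n -
   k. *)
subst hi0 n'; exists (Num.max M (k0 + n - k)) => m2 hm2.
exists (m2 + k - k0), m2; split.
- by move: h1; rewrite /in_nodes; case: lo0 => [a|] //=; lia.
- by rewrite /in_nodes /= lexx.
- apply: (@same_sequence _ _ _ _ _ _ _ _ _ _ _ (k0 - k)) => //=.
  + by congr Some; lia.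
  + move=> i; rewrite /in_nodes /= andbT => hi.
    rewrite Hx; last by rewrite /in_nodes /=; lia.
    have [-> _] := far (k0 - k + i) ltac:(lia); congr x; lia.
  + move=> i; rewrite /in_pieces /= andbT => hi.
    have [_ ->] := far (k0 - k + i) ltac:(lia).
    have -> : k0 - k + i + k = k0 + i by lia.
    by apply: HW; rewrite /in_pieces /=; lia.
Qed.

(** Merging matches entries rather than indices. So a wnode q1 of the outermost sequence is chosen
    beyond the first matched entry p0', and the bijection is restricted to the entries from the
    preimage of q1 on. *)
Lemma merging_tip_far w0 x W x' W' k M m :
  (forall i, M <= i -> x' i = x (i + k) /\ W' i = W (i + k)) ->
  eventually_identical_up_to_merging w0 (Walk VecOmega (Some m) None x W) ->
  exists N, forall m2, N <= m2 -> 
    eventually_identical_up_to_merging w0 (Walk VecOmega (Some m2) None x' W').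
Proof.
move=> far [p0 [p0' [f [hp0 hp0' [fmap finj fsurj] fmono fent]]]].
have [l0 ent0] := hp0'; have [j [b [s0 Ep0']]] := entry_cons ent0.
exists (Num.max M (Num.max (m - k) (j - k))) => m2 hm2.
(* By the choice of m2 this index exceeds the leading index j of p0'; the additional 1 makes the
   wnode nonterminal in both tails. *)
pose q1 : position := [:: (m2 + k + 1, false)].
set T := Walk VecOmega (Some m) None x W in hp0' fmap fsurj fent *.
set T2 := Walk VecOmega (Some m2) None x' W'.
have Tq1 : positions T q1.
  by exists (inl (x (m2 + k + 1))); apply: entry_node; rewrite /nonterminal /=; lia.
have p0q1 : (p0' <= q1)%O by rewrite ltW // Ep0' position_lt_cons; lia.
have [p1 [hp1 p01] fp1] : exists2 p, positions_from w0 p0 p & f p = q1.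
  by case: (fsurj q1 (conj Tq1 p0q1)) => p hp <-; exists p.
(* Above q1 the two tails have the same entries, up to the shift of indices. *)
have above (q : position) : (q1 <= q)%O -> exists i b' s, q = (i, b') :: s /\ m2 + k + 1 <= i.
  rewrite le_eqVlt => /predU1P [<-|]; first by exists (m2 + k + 1), false, [::].
  case: q => [//|[i b'] s]; rewrite position_lt_cons => h; exists i, b', s; split => //; lia.
have above' (q : position) : (shift_position k q1 <= q)%O -> exists i b' s, q = (i, b') :: s /\ m2 + 1 <= i.
  rewrite le_eqVlt => /predU1P [<-|].
    by exists (m2 + k + 1 - k), false, [::]; split => //; lia.
  case: q => [//|[i b'] s]; rewrite position_lt_cons => h; exists i, b', s; split => //; lia.
have to_T2 (q : position) l : (q1 <= q)%O -> entry T q l -> entry T2 (shift_position k q) l.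
  move=> /above [i [b' [s [-> mi]]]]; apply: (@entry_shift _ _ _ _ _ _ _ _ _ _ _ _ (m2 + k + 1)) => // i' _ hi'.
    have [] := far (i' - k) ltac:(lia); rewrite subrK => -> _; split => //.
    by rewrite /nonterminal /=; lia.
  have [] := far (i' - k) ltac:(lia); rewrite subrK => _ ->; split => //.
  by rewrite /in_pieces /=; lia.
have of_T2 (q : position) l : (shift_position k q1 <= q)%O -> entry T2 q l -> entry T (shift_position (- k) q) l.
  move=> /above' [i [b' [s [-> mi]]]]; apply: (@entry_shift _ _ _ _ _ _ _ _ _ _ _ _ (m2 + 1)) => // i' _ hi'; rewrite opprK.
    have [-> _] := far i' ltac:(lia); split => //.
    by rewrite /nonterminal /=; lia.
  have [_ ->] := far i' ltac:(lia); split => //.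
  by rewrite /in_pieces /=; lia.
have shift_le (p q : position) : (shift_position k p <= shift_position k q)%O = (p <= q)%O.
  by rewrite !leNgt shift_position_lt.
have shiftNK (q : position) : shift_position k (shift_position (- k) q) = q.
  by rewrite -{1}[k]opprK shift_positionK.
have mono (p : position) : positions_from w0 p1 p -> [/\ positions_from w0 p0 p, positions T (f p) & (q1 <= f p)%O].
  move=> [hp p1p]; have hp' : positions_from w0 p0 p by split => //; exact: le_trans p01 p1p.
  split => //; first by case: (fmap _ hp').
  move: p1p; rewrite le_eqVlt => /predU1P [<-|h]; first by rewrite fp1.
  by rewrite -fp1; apply/ltW/fmono.
exists p1, (shift_position k q1), (shift_position k \o f); split.
- by [].
- by exists (inl (x (m2 + k + 1))); apply: to_T2 => //; apply: entry_node; rewrite /nonterminal /=; lia.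
- split.
  + move=> p /mono [_ [l lp] q1p]; split; last by rewrite shift_le.
    by exists l; apply: to_T2.
  + move=> p q /set_mem /mono [hp _ _] /set_mem /mono [hq _ _] /= E.
    apply: finj; rewrite ?inE //.
    by rewrite -(shift_positionK k (f p)) E shift_positionK.
  + move=> q [[l hl] hq].
    have q1q : (q1 <= shift_position (- k) q)%O by rewrite -shift_le shiftNK.
    case: (fsurj (shift_position (- k) q)).
      split; last exact: le_trans p0q1 q1q.
      by exists l; apply: of_T2.
    move=> p hp fp; exists p; last by rewrite /= fp shiftNK.
    split; first by case: hp.
    rewrite leNgt; apply/negP => /(fmono _ _ hp (conj hp1 p01)).
    by rewrite fp fp1 ltNge q1q.
- move=> p q /mono [hp _ _] /mono [hq _ _] pq /=.
  by rewrite shift_position_lt; apply: fmono.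
- move=> p l /mono [hp _ q1p] /(fent _ _ hp) /=; exact: to_T2.
Qed.

Lemma tail_is_walk r lo x W : is_walk (Walk r lo None x W) ->
  exists N, forall m, N <= m -> is_walk (Walk r (Some m) None x W).
Proof.
move=> ww; pose a := if lo is Some a then a else 0.
have sub m : a <= m -> part_of 0 lo None x W (Some m) None x W.
  move=> am; apply: part_cut => i; rewrite /in_nodes /= !andbT.
  by move: am; rewrite /a; case: lo {ww a} => [b|] //=; lia.
have [rV|rV] := EM (r = VecOmega); last first.
  by exists a => m am; apply: (part_is_walk rV _ (sub m am)).
(* A tail starting left of the turning index c would first descend. *)
subst r; case/is_walk_vec: ww => c vw; exists (Num.max a c) => m hm.
apply/is_walk_vec; exists m; have am : a <= m by lia.
apply: (part_vec_walk _ (sub m am)) vw; first by split => //; right.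
by move=> i; rewrite /in_pieces /= addr0; lia.
Qed.

(** Both notions of eventual identity only see what happens from some index on. Cutting, gluing and
    replacing pieces preserve infinite ends by this lemma. The witnessing tail starts late enough to
    be a walk itself, as membership in a wtip demands. *)
Lemma end_right_far r lo lo' x x' W W' k M e : is_walk (Walk r lo' None x' W') ->
  (forall i, M <= i -> x' i = x (i + k) /\ W' i = W (i + k)) ->
  end_right (Walk r lo None x W) e -> end_right (Walk r lo' None x' W') e.
Proof.
move=> ww far [m [t [_ et tw]]]; case: (tips_wtip et) => r' _ [w0 w0r Et].
subst t; case: tw => -[_ /= Er _ _]; subst r' => st.
have [N1 walk1] := tail_is_walk ww.
have [N2 same2] : exists N, forall m2, N <= m2 -> same_tip r w0 (Walk r (Some m2) None x' W').
  have [rV|rV] := EM (r = VecOmega).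
    by subst r; exact: merging_tip_far far st.
  move: st => /=; case: r {w0r ww walk1 et} rV => [n||] // rV; exact: same_tip_far rV far.
have [m2 [hm1 hm2 hlo]] : exists m2, [/\ N1 <= m2, N2 <= m2 & ge_lo lo' m2].
  exists (Num.max (Num.max N1 N2) (if lo' is Some a then a else 0)).
  by split; try (case: lo' {ww} => [a|] //=); lia.
exists m2; eexists; split; [exact: hlo|exact: et|split].
- by split => //=; apply: walk1.
- exact: same2.
Qed.

End Ends.

(** * Concatenation *)

Section Concatenation.
Local Open Scope ring_scope.
Variables (G : wdata) (nu : rank) (hG : is_wgraph G nu) (rho : rank).
Variables (P : set G) (B : G -> G -> Prop).
Hypothesis B_sym : forall u v, B u v -> B v u.
Hypothesis P_tip : forall e t w, rle (rk e) rho -> tips e t -> t w ->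
  walk_in setT B w -> P e.
Implicit Types (x y : int -> G) (u v e X : G) (w : prewalk G) (W Z : int -> prewalk G).
Implicit Types (lo hi : option int) (r p s : rank) (k m a b : int) (L R : prewalk G).

Definition good w : Prop := is_walk w /\ walk_in P B w.

Lemma good_rev w : good w -> good (rev_walk w).
Proof.
by case=> h1 h2; split; [exact: is_walk_rev (wg_adj_sym hG) _ h1|exact: walk_in_rev].
Qed.

Lemma walk_in_setT w : walk_in P B w -> walk_in setT B w.
Proof.
elim: w => // r lo hi x W IH [_ h]; split => // m mp.
exact/IH/h.
Qed.

(** The tail at an infinite end represents its wtip inside B, so that [P_tip] applies. Bracketing an
    infinite walk turns such wnodes into terminal elements, which must again lie in P. *)
Lemma end_right_in w e : good w -> rle (rk e) rho -> end_right w e -> P e.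
Proof.
case: w => // r lo [j|] x W [ww [h1 h2]] er.
  by move=> /= <-; apply/h1/last_node/(is_walk_lohi ww).
case=> m [t [lom et tw]]; apply: (P_tip er et tw); apply: walk_in_setT.
apply: (@part_walk_in G 0) (conj h1 h2); apply: part_cut => i.
by rewrite /in_nodes /= !andbT; case: (lo) lom => [a|] //=; lia.
Qed.

Lemma end_left_in w e : good w -> rle (rk e) rho -> end_left w e -> P e.
Proof. by move=> /good_rev; apply: end_right_in. Qed.

Definition finite w : Prop := ~ left_infinite w /\ ~ right_infinite w.

Lemma single_piece s p w el er : rpred s = Some p -> rle s rho -> good w ->
  nontrivial w -> rlt (walk_rank w) s -> end_left w el -> end_right w er ->
  let R := Walk s (Some 0) (Some 1) (fun m => if m <= 0 then el else er) (fun=> w) in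
  good R /\ forall f, walk_length R f = walk_length w f.
Proof.
move=> sp srho gw nw ws wl wr R; have [ww iw] := gw.
have wwr := is_walk_rev (wg_adj_sym hG) ww.
have rl : rle (rk el) s by apply: (end_right_lt hG wwr) wl; rewrite walk_rank_rev.
have rr : rle (rk er) s by apply: (end_right_lt hG ww) wr.
have hx m : rle (rk (if m <= 0 then el else er)) s by case: ifP.
split; last first.
  by move=> f; rewrite walk_length_two /= piece_sum1.
split.
  apply/(is_walk_reg _ _ _ _ sp); split => //.
  - by move=> m; rewrite /nonterminal /=; lia.
  - move=> m; rewrite /in_pieces /= => hm; have -> : m = 0 by lia.
    split => //=; first by apply/reaches_leftE; exists el => //; exact: embraces_refl.
    by apply/reaches_rightE; exists er => //; exact: embraces_refl.
  - by move=> m; rewrite /nonterminal /=; lia.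
split => // m _; case: ifP => _.
  by apply: (end_left_in gw) => //; exact: rle_trans srho.
by apply: (end_right_in gw) => //; exact: rle_trans srho.
Qed.

Lemma to_rank s w el er : s <> VecOmega -> rle s rho -> good w ->
  nontrivial w -> rle (walk_rank w) s -> (walk_rank w = s -> finite w) ->
  end_left w el -> end_right w er ->
  exists R, [/\ good R, nontrivial R, walk_rank R = s & finite R] /\
    [/\ end_left R el, end_right R er & forall f, walk_length R f = walk_length w f].
Proof.
move=> sV srho gw nw ws fw wl wr; case: (rle_eqVlt ws) => [E|lt].
  by exists w; split; split => //; case: (fw E).
have [p sp] : exists p, rpred s = Some p.
  by case: s sV lt {srho ws fw} => [[|n]||] // _; [case: (walk_rank w)|exists (Fin n)|exists VecOmega].
case: (single_piece sp srho gw nw lt wl wr) => gR lR.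
eexists; split; split.
- exact: gR.
- by exists 0.
- by [].
- by split => -[].
- by rewrite /end_left /= ?oppr0.
- by [].
- exact: lR.
Qed.

(** What a modified walk must retain at an end for the conditions there to remain valid. For wnodes
    one implication suffices, since ends are only transferred from w to w'. *)
Definition sim_right w w' : Prop :=
  (right_infinite w' <-> right_infinite w) /\
  forall e, end_right w e -> end_right w' e.

Definition sim_left w w' : Prop := sim_right (rev_walk w) (rev_walk w').

Lemma sim_right_reaches w w' u :
  sim_right w w' -> reaches_right w u -> reaches_right w' u.
Proof.
move=> [_ h] /reaches_rightE [e ue we]; apply/reaches_rightE.
by exists e => //; exact: h.
Qed.

Lemma sim_left_reaches w w' u :
  sim_left w w' -> reaches_left w u -> reaches_left w' u.
Proof. exact: sim_right_reaches. Qed.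

Lemma sim_right_by r w w' u : walk_rank w' = walk_rank w ->
  sim_right w w' -> reaches_right_by r w u -> reaches_right_by r w' u.
Proof.
move=> E sim [h1 h2 h3]; split; [by apply sim|by rewrite E|].
exact: sim_right_reaches sim h3.
Qed.

Lemma sim_left_by r w w' u : walk_rank w' = walk_rank w ->
  sim_left w w' -> reaches_left_by r w u -> reaches_left_by r w' u.
Proof.
move=> E sim; rewrite -!reaches_right_by_rev; apply: sim_right_by sim.
by rewrite !walk_rank_rev.
Qed.

Definition len_le w w1 w2 : Prop :=
  forall f, (walk_length w f <= walk_length w1 f + walk_length w2 f)%N.

Definition cat_spec L R w : Prop :=
  [/\ good w, nontrivial w & walk_rank w = walk_rank L] /\
  [/\ sim_left L w, sim_right R w & len_le w L R].

Lemma cat_spec_rev L R w : good L -> good R -> walk_rank L = walk_rank R ->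
  cat_spec (rev_walk R) (rev_walk L) w -> cat_spec L R (rev_walk w).
Proof.
move=> gL gR E [[g n r] [sl sr le]]; split; split.
- exact: good_rev.
- exact: nontrivial_rev.
- by rewrite walk_rank_rev r walk_rank_rev.
- by rewrite /sim_left rev_walkK.
- by move: sl; rewrite /sim_left rev_walkK.
- move=> f; rewrite walk_length_rev; last by case: g.
  by move: (le f); rewrite addnC !walk_length_rev //; [case: gR|case: gL].
Qed.

(* Infinite walks of the same rank have lengths that depend only on which
   sides are infinite. *)
Lemma len_le_infinite r lo b x W a hi y Z lo' hi' x' W' :
  (lo' = None <-> lo = None) -> (hi' = None <-> hi = None) ->
  lo = None \/ hi = None ->
  len_le (Walk r lo' hi' x' W') (Walk r lo (Some b) x W) (Walk r (Some a) hi y Z).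
Proof.
move=> Elo Ehi inf f; case: lo Elo inf => [l|] Elo; case: hi Ehi => [h|] Ehi //= inf.
- by case: inf.
- have -> : hi' = None by apply/Ehi.
  by case: lo' Elo => [l'|[/(_ erefl)]] //; rewrite leq_addl.
- have -> : lo' = None by apply/Elo.
  by case: hi' Ehi => [l'|[/(_ erefl)]] //; rewrite leq_addr.
- have -> : lo' = None by apply/Elo.
  have -> : hi' = None by apply/Ehi.
  by rewrite !wpowE; case: ifP.
Qed.

(** * Gluing two walks at a common terminal wnode *)

Definition glue_nodes b k x y m := if m <= b then x m else y (m + k).
Definition glue_pieces b k W Z m := if m < b then W m else Z (m + k).

Section Glue.
Variables (r : rank) (lo hi : option int) (a b : int).
Variables (x y : int -> G) (W Z : int -> prewalk G).
Let L := Walk r lo (Some b) x W.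
Let R := Walk r (Some a) hi y Z.
Let k := a - b.
Let hi' := omap (+%R (b - a)) hi.
Let xy := glue_nodes b k x y.
Let WZ := glue_pieces b k W Z.
Let w := Walk r lo hi' xy WZ.
Hypotheses (gL : good L) (gR : good R) (eab : x b = y a).

Let lo_b : in_nodes lo (Some b) b.
Proof. by apply/last_node/(is_walk_lohi gL.1). Qed.

Let a_hi : in_nodes (Some a) hi a.
Proof. by apply/first_node/(is_walk_lohi gR.1). Qed.

Lemma glue_node m : in_nodes lo hi' m ->
  [/\ m < b, in_nodes lo (Some b) m & xy m = x m] \/
  [/\ b <= m, in_nodes (Some a) hi (m + k) & xy m = y (m + k)].
Proof.
move=> mn; have [mb|bm] := ltP m b; [left|right]; split => //.
- by move: mn; rewrite /in_nodes /=; case: (lo) => [l|] /=; lia.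
- by rewrite /xy /glue_nodes (ltW mb).
- by move: mn; rewrite /in_nodes /hi' /k; case: (hi) => [h|] /=; lia.
- rewrite /xy /glue_nodes; case: ifP => // mb; have -> : m = b by lia.
  by rewrite eab; congr y; rewrite /k; lia.
Qed.

Lemma glue_piece m : in_pieces lo hi' m ->
  [/\ m < b, in_pieces lo (Some b) m & [/\ WZ m = W m, xy m = x m & xy (m + 1) = x (m + 1)]] \/
  [/\ b <= m, in_pieces (Some a) hi (m + k)
    & [/\ WZ m = Z (m + k), xy m = y (m + k) & xy (m + 1) = y (m + k + 1)]].
Proof.
move=> mn; have [mb|bm] := ltP m b; [left|right]; split => //.
- by move: mn; rewrite /in_pieces /=; case: (lo) => [l|] /=; lia.
- rewrite /WZ /xy /glue_nodes /glue_pieces mb (ltW mb); split => //.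
  by have -> : m + 1 <= b by lia.
- by move: mn; rewrite /in_pieces /hi' /k; case: (hi) => [h|] /=; lia.
- rewrite /WZ /xy /glue_nodes /glue_pieces ltNge bm; split => //.
    case: ifP => // mb; have -> : m = b by lia.
    by rewrite eab; congr y; rewrite /k; lia.
  have -> : (m + 1 <= b) = false by lia.
  by congr y; lia.
Qed.

Lemma glue_walk_in : walk_in P B w.
Proof.
have [_ [h1 h2]] := gL; have [_ [g1 g2]] := gR; split => m.
  by case/glue_node => -[_ h ->]; [exact: h1|exact: g1].
by case/glue_piece => -[_ h [-> _ _]]; [exact: h2|exact: g2].
Qed.

Lemma glue_lohi : lohi lo hi'.
Proof.
move: lo_b a_hi; rewrite /lohi /hi'; case: (lo) (hi) => [l|] [h|] //=; rewrite /in_nodes /=; lia.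
Qed.

Lemma glue_spec : is_walk w -> nontrivial L \/ nontrivial R -> cat_spec L R w.
Proof.
move=> ww nLR.
have hb := lo_b; have ha := a_hi.
split; split => //.
- by split => //; exact: glue_walk_in.
- case: nLR => -[m hm].
    exists m; move: hm ha; rewrite /in_pieces /in_nodes /hi'; case: (lo) (hi) => [l|] [h|] /=; lia.
  exists (m - k); move: hm hb; rewrite /in_pieces /in_nodes /hi' /k; case: (lo) (hi) => [l|] [h|] /=; lia.
- have wr := is_walk_rev (wg_adj_sym hG) ww.
  have E i : - b + 1 <= i -> xy (- i) = x (- i) /\ WZ (- i - 1) = W (- i - 1).
    move=> hi_; rewrite /xy /WZ /glue_nodes /glue_pieces.
    by have [-> ->] : (- i <= b) /\ (- i - 1 < b) by lia.
  move: wr hb; rewrite /sim_left /w /L; case: (lo) => [l|] wr hb; split => // e.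
    by move=> /= <-; rewrite opprK /xy /glue_nodes; move: hb; rewrite /in_nodes /= => /andP [-> _].
  apply: (@end_right_far G nu hG r _ _ _ _ _ _ 0 (- b + 1) e wr) => i /E [-> ->].
  by rewrite addr0.
- move: ww ha; rewrite /w /R /hi'; case: (hi) => [h|] ww ha; split => // e.
    move=> /= <-; rewrite /xy /glue_nodes; case: ifP => hb'; last by congr (y _); rewrite /k; lia.
    have -> : b - a + h = b by move: ha; rewrite /in_nodes /=; lia.
    by rewrite eab; congr y; move: ha; rewrite /in_nodes /=; lia.
  apply: (@end_right_far G nu hG r _ _ _ _ _ _ k (b + 1) e ww) => i hi_.
  rewrite /xy /WZ /glue_nodes /glue_pieces.
  by have [-> ->] : (i <= b) = false /\ (i < b) = false by lia.
- have [[l [h [El Eh]]]|inf] := EM (exists l h, lo = Some l /\ hi = Some h); last first.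
    apply: len_le_infinite => //; first by rewrite /hi'; case: (hi).
    case El : lo => [l|]; last by left.
    by case Eh : hi => [h|]; [case: inf; exists l, h|right].
  move=> f; move: hb ha; rewrite /w /L /R /hi' El Eh /in_nodes /= => hb ha.
  rewrite (walk_length_two r _ _ xy) (walk_length_two r _ _ x) (walk_length_two r _ _ y).
  have -> : absz (b - a + h - l)%R = addn (absz (b - l)%R) (absz (h - a)%R) by lia.
  rewrite piece_sumD; apply: eq_leq; congr addn; apply: piece_sum_eq => i hi_.
    by rewrite /WZ /glue_pieces; have -> : l + i%:Z < b by lia.
  rewrite /WZ /glue_pieces; have -> : (l + (absz (b - l)%R)%:Z + i%:Z < b) = false by lia.
  by congr Z; rewrite /k; lia.
Qed.

(** The index b is the only nonterminal one that is not inherited from L or R, and it is nonterminal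
    only if both walks have a piece there. *)
Lemma glue_is_walk_reg p : rpred r = Some p ->
  (in_pieces lo (Some b) (b - 1) -> in_pieces (Some a) hi a ->
   rk (x b) = r /\
   (reaches_right_by p (W (b - 1)) (x b) \/ reaches_left_by p (Z a) (x b))) ->
  is_walk w.
Proof.
move=> rp junction.
have [/(is_walk_reg _ _ _ _ rp) [h0 h1 h2 h3 h4] _] := gL.
have [/(is_walk_reg _ _ _ _ rp) [g0 g1 g2 g3 g4] _] := gR.
apply/(is_walk_reg _ _ _ _ rp); split.
- exact: glue_lohi.
- by move=> m /glue_node [[_ h ->]|[_ h ->]]; [exact: h1|exact: g1].
- move=> m mn; have [/glue_node mn1 mp mp'] := nonterminal_nodes mn.
  case: (ltgtP m b) => mb.
  + case: mn1 => -[mb1 hm ->]; last by lia.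
    apply: h2; move: mn; rewrite /nonterminal /=; case: (lo) => [l|] /=; lia.
  + case: mn1 => -[mb1 hm ->]; first by lia.
    apply: g2; move: mn; rewrite /nonterminal /hi' /k /=; case: (hi) => [h|] /=; lia.
  + case: mn1 => -[mb1 hm E]; first by lia.
    have [|| rb _] := junction.
    * by move: mn; rewrite mb /nonterminal /in_pieces /=; case: (lo) => [l|] /=; lia.
    * by move: mn; rewrite mb /nonterminal /in_pieces /hi' /=; case: (hi) => [h|] /=; lia.
    * by rewrite E -rb eab; congr (rk (y _)); rewrite mb /k; lia.
- move=> m /glue_piece [[_ h [E1 E2 E3]]|[_ h [E1 E2 E3]]]; rewrite /piece_ok E1 E2 E3.
    exact: h3.
  exact: g3.
- move=> m mn; have [mn' /glue_piece mp /glue_piece mp'] := nonterminal_nodes mn.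
  rewrite /junction_ok; case: (ltgtP m b) => mb.
  + case: mp' => -[mb2 _ [-> -> _]]; last by lia.
    case: mp => -[mb3 _ [-> _ _]]; last by lia.
    by apply: h4; move: mn; rewrite /nonterminal /=; case: (lo) => [l|] /=; lia.
  + case: mp' => -[mb2 _ [-> -> _]]; first by lia.
    case: mp => -[mb3 _ [-> _ _]]; first by lia.
    have -> : m - 1 + k = m + k - 1 by lia.
    by apply: g4; move: mn; rewrite /nonterminal /hi' /k /=; case: (hi) => [h|] /=; lia.
  + case: mp' => -[mb2 hp' [-> -> _]]; first by lia.
    case: mp => -[mb3 hp [-> _ _]]; last by lia.
    have Ea : m + k = a by rewrite /k; lia.
    rewrite Ea -eab mb; rewrite mb in hp; rewrite Ea in hp'.
    by case: (junction hp hp').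
Qed.

Lemma glue_is_walk_0 : r = Fin 0 -> is_walk w.
Proof.
have [wL _] := gL; have [wR _] := gR; rewrite /w => r0.
move: wL wR; rewrite /L /R r0 => /is_walk_0 [h0 h1 h2] /is_walk_0 [g0 g1 g2].
apply/is_walk_0; split.
- exact: glue_lohi.
- by move=> m /glue_node [[_ h ->]|[_ h ->]]; [exact: h1|exact: g1].
- move=> m /glue_piece [[_ h [E1 E2 E3]]|[_ h [E1 E2 E3]]]; rewrite E1 E2 E3.
    exact: h2.
  exact: g2.
Qed.

Lemma glue_is_walk_vec : r = VecOmega -> lo = None -> hi = None -> is_walk w.
Proof.
have [wL _] := gL; have [wR _] := gR; rewrite /w => rV Elo Ehi.
move: wL wR; rewrite /L /R rV => /is_walk_vec [c [[_ Ec _] h1 h2]].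
move=> /is_walk_vec [c' [[Ec' _ _] g1 g2]]; subst c c'.
apply/is_walk_vec; exists b; split.
- by split; rewrite /hi' ?Elo ?Ehi //; left.
- by move=> m /glue_node [[_ h ->]|[_ h ->]]; [exact: h1|exact: g1].
- move=> m /glue_piece [[mb h [E1 E2 E3]]|[mb h [E1 E2 E3]]]; rewrite /vec_piece E1 E2 E3.
    exact: h2.
  have -> : (b <= m) = (a <= m + k) by rewrite /k; lia.
  exact: g2.
Qed.

End Glue.

Lemma sim_right_trans w2 w1 w3 : sim_right w1 w2 -> sim_right w2 w3 -> sim_right w1 w3.
Proof.
move=> [i12 e12] [i23 e23]; split=> [|e /e12 /e23 //]; split.
  by move=> /i23 /i12.
by move=> /i12 /i23.
Qed.

Lemma sim_left_trans w2 w1 w3 : sim_left w1 w2 -> sim_left w2 w3 -> sim_left w1 w3.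
Proof. exact: sim_right_trans. Qed.

Lemma last_piece lo b : (exists m, in_pieces lo (Some b) m) ->
  in_pieces lo (Some b) (b - 1).
Proof. by case=> m; rewrite /in_pieces /=; case: lo => [l|] /=; lia. Qed.

Lemma first_piece a hi : (exists m, in_pieces (Some a) hi m) ->
  in_pieces (Some a) hi a.
Proof. by case=> m; rewrite /in_pieces /=; case: hi => [l|] /=; lia. Qed.

(** The terminal wnode is subject to no junction condition and may be changed. The wnode before it
    may owe its condition to a wtip of the old last piece, so V must inherit that wtip. *)
Lemma replace_last r p lo b x W (V : prewalk G) J : rpred r = Some p ->
  let L := Walk r lo (Some b) x W in
  let L' := Walk r lo (Some b) (fun m => if m < b then x m else J)
              (fun m => if m < b - 1 then W m else V) in
  good L -> in_pieces lo (Some b) (b - 1) ->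
  good V -> nontrivial V -> rlt (walk_rank V) r -> reaches_left V (x (b - 1)) ->
  (reaches_left_by p (W (b - 1)) (x (b - 1)) -> reaches_left_by p V (x (b - 1))) ->
  reaches_right V J -> rle (rk J) r -> P J ->
  good L' /\ sim_left L L'.
Proof.
move=> rp L L' gL hb gV nV Vr Vl Vby VJ Jr PJ.
have [/(is_walk_reg _ _ _ _ rp) [h0 h1 h2 h3 h4] [i1 i2]] := gL.
have wL' : is_walk L'.
  apply/(is_walk_reg _ _ _ _ rp); split => //.
  - by move=> m mn; case: ifP => // _; exact: h1.
  - move=> m mn; have -> : m < b by move: mn; rewrite /nonterminal /=; lia.
    exact: h2.
  - move=> m mp; rewrite /piece_ok; have mb : m < b by move: mp; rewrite /in_pieces /=; lia.
    rewrite mb; case: ifP => mb'.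
      have -> : m + 1 < b by lia.
      exact: h3.
    have Em : m = b - 1 by lia.
    have -> : m + 1 < b = false by lia.
    by rewrite Em; split => //; case: gV.
  - move=> m mn; have mb : m < b by move: mn; rewrite /nonterminal /=; lia.
    rewrite /junction_ok mb; have -> : m - 1 < b - 1 by lia.
    case: (h4 m mn) => h; first by left.
    right; case: ifP => mb' //.
    have Em : m = b - 1 by lia.
    by move: h; rewrite Em; exact: Vby.
split.
  split => //; split => m mp.
    by case: ifP => // _; exact: i1.
  by case: ifP => // _; [exact: i2|case: gV].
have wr := is_walk_rev (wg_adj_sym hG) wL'.
move: hb wr; rewrite /sim_left /L /L'; case: (lo) => [l|] hb wr; split => // e.
  move=> /= <-; rewrite opprK; have -> // : l < b.
  by move: hb; rewrite /in_pieces /=; lia.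
apply: (@end_right_far G nu hG r _ _ _ _ _ _ 0 (- b + 2) e wr) => i ib; rewrite addr0.
by have [-> ->] : (- i < b) /\ (- i - 1 < b - 1) by lia.
Qed.

(* Two pieces of an r-walk that meet at X, neither through a wtip of rank
   p = r - 1, can be replaced by a single piece. *)
Definition mergeable r p : Prop := forall L R X xl xr,
  [/\ good L, nontrivial L, rlt (walk_rank L) r, reaches_left L xl & reaches_right L X] ->
  [/\ good R, nontrivial R, rlt (walk_rank R) r, reaches_left R X & reaches_right R xr] ->
  ~ (right_infinite L /\ walk_rank L = p) ->
  ~ (left_infinite R /\ walk_rank R = p) ->
  exists V, [/\ good V, nontrivial V, rlt (walk_rank V) r & len_le V L R] /\
    [/\ reaches_left V xl, reaches_right V xr,
        (reaches_left_by p L xl -> reaches_left_by p V xl)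
      & (reaches_right_by p R xr -> reaches_right_by p V xr)].

Definition concatenable r : Prop := forall L R X,
  [/\ good L, nontrivial L, walk_rank L = r, ~ right_infinite L & reaches_right L X] ->
  [/\ good R, nontrivial R, walk_rank R = r, ~ left_infinite R & reaches_left R X] ->
  exists w, cat_spec L R w.

Section CatStep.
Variables (r p : rank) (lo hi : option int) (a b : int).
Variables (x y : int -> G) (W Z : int -> prewalk G) (X : G).
Let L := Walk r lo (Some b) x W.
Let R := Walk r (Some a) hi y Z.
Hypotheses (rp : rpred r = Some p) (gL : good L) (gR : good R).
Hypotheses (lastL : in_pieces lo (Some b) (b - 1)) (firstR : in_pieces (Some a) hi a).
Hypotheses (Xb : embraces X (x b)) (Xa : embraces X (y a)).

(** The wnode containing this p-wtip has rank r and is embraced by y a, hence equals it. So y a has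
    the largest possible rank, embraces x b, and L can be made to terminate at y a, where the wtip
    of R satisfies the junction condition. *)
Lemma cat_tip : left_infinite (Z a) -> walk_rank (Z a) = p ->
  exists w, cat_spec L R w.
Proof.
move=> inf rZ.
have [/(is_walk_reg _ _ _ _ rp) [h0 h1 h2 h3 h4] [i1 i2]] := gL.
have [/(is_walk_reg _ _ _ _ rp) [g0 g1 g2 g3 g4] [j1 j2]] := gR.
have [_ _ _ /reaches_leftE [e ye Ze] _] := g3 a firstR.
have re : rk e = r.
  by have := end_left_infinite hG inf Ze; rewrite rZ => re; exact: rpred_inj re rp.
have [an _] := pieces_nodes firstR.
have Ey : y a = e by apply: (embraces_eq hG ye); rewrite re; exact: g1.
have ra : rk (y a) = r by rewrite Ey.
have yx : embraces (y a) (x b).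
  by apply: (embraces_cmp hG Xa Xb); rewrite ra; apply/h1/last_node.
have [k1 k2 k3 k4 k5] := h3 _ lastL; have [_ Wg] := gL.
have gW : good (W (b - 1)) by split => //; case: Wg => _; apply.
rewrite subrK in k5.
have [|gL' sL'] := @replace_last r p lo b x W (W (b - 1)) (y a) rp gL lastL gW k2 k3 k4 id
  (reaches_right_trans k5 yx) _ (j1 a an).
  by rewrite ra rle_refl.
set L' := Walk _ _ _ _ _ in gL' sL'.
have nL' : nontrivial L' by exists (b - 1).
have [w [w1 [w2 w3 w4]]] : exists w, cat_spec L' R w.
  have eab : (if b < b then x b else y a) = y a by rewrite ltxx.
  eexists; apply: (glue_spec gL' gR eab); last by left.
  apply: (glue_is_walk_reg gL' gR eab rp) => _ _.
  rewrite ltxx; split => //; right; split => //.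
  by apply/reaches_leftE; exists e.
exists w; split => //; split => //; first exact: sim_left_trans sL' w2.
move=> f; apply: leq_trans (w4 f) _; rewrite leq_add2r.
rewrite /L' /L; case: (lo) lastL => [l|] lastL' //.
rewrite (walk_length_two r _ _ x) (walk_length_two r l b (fun m => if m < b then x m else y a)).
apply/eq_leq/piece_sum_eq => i ib; case: ifP => // hi_.
by move: lastL'; rewrite /in_pieces /= => lastL'; congr W; lia.
Qed.

End CatStep.

Lemma good_pieces r p lo hi x W m : rpred r = Some p ->
  good (Walk r lo hi x W) -> in_pieces lo hi m -> good (W m).
Proof.
move=> rp [/(is_walk_reg _ _ _ _ rp) [_ _ _ h _] [_ i]] mp.
by split; [case: (h m mp)|exact: i].
Qed.

(** If a p-wtip is used at the meeting point, [cat_tip] applies, possibly after reversal. Otherwise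
    the two adjacent pieces are merged into V, which becomes the last piece of L and ends at the
    second wnode of R; the rest of R is glued there. *)
Lemma cat_step r p : rpred r = Some p -> mergeable r p -> concatenable r.
Proof.
move=> rp merge [u v|r1 lo hi1 x W] R X [gL nL rL fL LX]; first by case: gL.
case: R => [u v|r2 lo2 hi y Z] [gR nR rR fR RX]; first by case: gR.
rewrite /= in rL rR; subst r1 r2.
case: hi1 gL nL fL LX => [b|] gL nL fL LX; last by case: fL.
case: lo2 gR nR fR RX => [a|] gR nR fR RX; last by case: fR.
have lastL : in_pieces lo (Some b) (b - 1) by exact: last_piece.
have firstR : in_pieces (Some a) hi a by exact: first_piece.
have Xb : embraces X (x b) by [].
have Xa : embraces X (y a) by move: RX; rewrite /reaches_left /= opprK.
have [[inf rZ]|nZ] := EM (left_infinite (Z a) /\ walk_rank (Z a) = p).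
  exact: (cat_tip rp gL gR lastL firstR Xb Xa inf rZ).
have [[inf rW]|nW] := EM (right_infinite (W (b - 1)) /\ walk_rank (W (b - 1)) = p).
  have Eb : - - b - 1 = b - 1 by rewrite opprK.
  have gL' := good_rev gL; have gR' := good_rev gR.
  have := @cat_tip r p (omap -%R hi) (omap -%R lo) (- b) (- a) _ _ _ _ X rp gR' gL'.
  case; rewrite ?opprK ?left_infinite_rev ?walk_rank_rev //.
  - by move: firstR; rewrite /in_pieces; case: (hi) => [h|] /=; lia.
  - by move: lastL; rewrite /in_pieces; case: (lo) => [l|] /=; lia.
  by move=> w hw; exists (rev_walk w); apply: cat_spec_rev.
have [/(is_walk_reg _ _ _ _ rp) [h0 h1 h2 h3 h4] [i1 i2]] := gL.
have [/(is_walk_reg _ _ _ _ rp) [g0 g1 g2 g3 g4] [j1 j2]] := gR.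
have [k1 k2 k3 k4 k5] := h3 _ lastL; rewrite subrK in k5.
have [l1 l2 l3 l4 l5] := g3 _ firstR.
have gW := good_pieces rp gL lastL; have gZ := good_pieces rp gR firstR.
have [||V [[gV nV rV lV] [Vl Vr Vlb Vrb]]] := merge (W (b - 1)) (Z a) X (x (b - 1)) (y (a + 1)) _ _ nW nZ.
- by split => //; exact: reaches_right_trans k5 Xb.
- by split => //; exact: reaches_left_trans l4 Xa.
have [_ a1n] := pieces_nodes firstR.
have [gL' sL'] := @replace_last r p lo b x W V (y (a + 1)) rp gL lastL gV nV rV Vl Vlb Vr
  (g1 _ a1n) (j1 _ a1n).
set L' := Walk _ _ _ _ _ in gL' sL'.
pose R' := Walk r (Some (a + 1)) hi y Z.
have sub : part_of 0 (Some a) hi y Z (Some (a + 1)) hi y Z.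
  by apply: part_cut => m; rewrite /in_nodes /=; lia.
have wR' : is_walk R'.
  apply: (part_is_walk _ _ sub) (gR.1); first by move=> E; rewrite E in rp.
  by move: a1n; rewrite /in_nodes /lohi /=; case: (hi) => [h|] //=; lia.
have gR' : good R' by split => //; exact: part_walk_in sub gR.2.
have sR' : sim_right (Walk r (Some a) hi y Z) R'.
  move: wR'; rewrite /R'; case: (hi) => [h|] wR'; split => // e.
  by apply: (@end_right_far G nu hG r _ _ _ _ _ _ 0 0 e wR') => i _; rewrite addr0.
have eab : (if b < b then x b else y (a + 1)) = y (a + 1) by rewrite ltxx.
have [w [w1 [w2 w3 w4]] Ew] : exists2 w, cat_spec L' R' w &
    exists x' W', w = Walk r lo (omap (+%R (b - (a + 1))) hi) x' W'.
  eexists; last by eexists; eexists; reflexivity.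
  apply: (glue_spec gL' gR' eab); last by left; exists (b - 1).
  apply: (glue_is_walk_reg gL' gR' eab rp) => _ a1p.
  have nt : nonterminal (Some a) hi (a + 1).
    by move: a1p; rewrite /in_pieces /nonterminal /=; case: (hi) => [h|] /=; lia.
  rewrite ltxx (g2 _ nt); split => //.
  have -> : b - 1 < b - 1 = false by rewrite ltxx.
  (* The wtip used at this wnode in R is that of the first piece, which V retains, or that of the
     second piece, which is unchanged. *)
  by case: (g4 _ nt); [rewrite addrK => /Vrb; left|right].
exists w; split => //; split.
- exact: sim_left_trans sL' w2.
- exact: sim_right_trans sR' w3.
case: Ew => x' [W' Ew]; have [[l [h [El Eh]]]|inf] := EM (exists l h, lo = Some l /\ hi = Some h); last first.
  rewrite Ew; apply: len_le_infinite => //; first by case: (hi).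
  case El : lo => [l|]; last by left.
  by case Eh : hi => [h|]; [case: inf; exists l, h|right].
move=> f; apply: leq_trans (w4 f) _; rewrite /L' /R'.
move: lastL firstR; rewrite El Eh /in_pieces /= => lastL firstR.
rewrite (walk_length_two r l b x W) (walk_length_two r a h y Z) (walk_length_two r (a + 1) h y Z).
rewrite (walk_length_two r l b (fun m => if m < b then x m else y (a + 1)) (fun m => if m < b - 1 then W m else V)).
have -> : absz (b - l)%R = addn (absz (b - 1 - l)%R) 1 by lia.
have -> : absz (h - a)%R = addn 1 (absz (h - (a + 1))%R) by lia.
rewrite !piece_sumD !piece_sum1.
have -> : l + (absz (b - 1 - l)%R)%:Z = b - 1 by lia.
rewrite ltxx.
have -> : piece_sum (fun m => if m < b - 1 then W m else V) l (absz (b - 1 - l)%R) f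
  = piece_sum W l (absz (b - 1 - l)%R) f.
  by apply: piece_sum_eq => i hi_; have -> : l + i%:Z < b - 1 by lia.
by rewrite -!addnA leq_add2l !addnA leq_add2r; exact: lV.
Qed.

(** Two 0-nodes embraced by the same wnode are comparable, hence equal. *)
Lemma cat_0 : concatenable (Fin 0).
Proof.
move=> [u v|r1 lo hi1 x W] R X [gL nL rL fL LX]; first by case: gL.
case: R => [u v|r2 lo2 hi y Z] [gR nR rR fR RX]; first by case: gR.
rewrite /= in rL rR; subst r1 r2.
case: hi1 gL nL fL LX => [b|] gL nL fL LX; last by case: fL.
case: lo2 gR nR fR RX => [a|] gR nR fR RX; last by case: fR.
have Xb : embraces X (x b) by [].
have Xa : embraces X (y a) by move: RX; rewrite /reaches_left /= opprK.
have [/is_walk_0 [h0 h1 _] _] := gL; have [/is_walk_0 [g0 g1 _] _] := gR.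
have rx := h1 _ (last_node h0); have ry := g1 _ (first_node g0).
have eab : x b = y a.
  apply: (embraces_eq hG); last by rewrite rx ry.
  by apply: (embraces_cmp hG Xb Xa); rewrite rx ry.
eexists; apply: (glue_spec gL gR eab); last by left.
exact: (glue_is_walk_0 gL gR eab).
Qed.

(** A piece of rank below n is first bracketed into a two-ended n-walk, and a piece of rank n is not
    infinite at X, so both can be concatenated at rank n. Bracketing loses no n-wtip at the outer
    ends, as only a piece of rank n has one. *)
Lemma merge_step n : rle (Fin n) rho -> concatenable (Fin n) ->
  mergeable (Fin n.+1) (Fin n).
Proof.
move=> nrho cat L R X xl xr [gL nL rL Lxl LX] [gR nR rR RX Rxr] fL fR.
have rL' : rle (walk_rank L) (Fin n) := rlt_rpred (s := Fin n.+1) erefl rL.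
have rR' : rle (walk_rank R) (Fin n) := rlt_rpred (s := Fin n.+1) erefl rR.
have lt_S : rlt (Fin n) (Fin n.+1) by rewrite /rlt /= ltnn.
have [L' [[gL' nL' rkL' fL'] [L'xl L'X L'by lenL']]] : exists L',
   [/\ good L', nontrivial L', walk_rank L' = Fin n & ~ right_infinite L'] /\
   [/\ reaches_left L' xl, reaches_right L' X, 
       (reaches_left_by (Fin n) L xl -> reaches_left_by (Fin n) L' xl)
     & forall f, walk_length L' f = walk_length L f].
  have [E|E] := EM (walk_rank L = Fin n).
    by exists L; split; split => //; move=> inf; apply: fL.
  move/reaches_leftE: Lxl => [el xel Lel]; move/reaches_rightE: LX => [er Xer Ler].
  have [//|//|w [[g1 g2 g3 [g4 g4']] [g5 g6 g7]]] := to_rank _ nrho gL nL rL' _ Lel Ler.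
  exists w; split; split => //.
  - by apply/reaches_leftE; exists el.
  - by apply/reaches_rightE; exists er.
  - by case.
have [R' [[gR' nR' rkR' fR'] [R'xr R'X R'by lenR']]] : exists R',
   [/\ good R', nontrivial R', walk_rank R' = Fin n & ~ left_infinite R'] /\
   [/\ reaches_right R' xr, reaches_left R' X, 
       (reaches_right_by (Fin n) R xr -> reaches_right_by (Fin n) R' xr)
     & forall f, walk_length R' f = walk_length R f].
  have [E|E] := EM (walk_rank R = Fin n).
    by exists R; split; split => //; move=> inf; apply: fR.
  move/reaches_leftE: RX => [el xel Lel]; move/reaches_rightE: Rxr => [er Xer Ler].
  have [//|//|w [[g1 g2 g3 [g4 g4']] [g5 g6 g7]]] := to_rank _ nrho gR nR rR' _ Lel Ler.
  exists w; split; split => //.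
  - by apply/reaches_rightE; exists er.
  - by apply/reaches_leftE; exists el.
  - by case.
have [||V [[gV nV rV] [sl sr le]]] := cat L' R' X; [by split|by split|].
exists V; split; split.
- by [].
- by [].
- by rewrite rV rkL'.
- by move=> f; rewrite -lenL' -lenR'.
- exact: sim_left_reaches sl L'xl.
- exact: sim_right_reaches sr R'xr.
- by move=> /L'by; apply: sim_left_by.
- by move=> /R'by; apply: sim_right_by; rewrite // rV rkL'.
Qed.

Lemma cat_fin n : rle (Fin n) rho -> concatenable (Fin n).
Proof.
elim: n => [|n IH] nrho; first exact: cat_0.
have nrho' : rle (Fin n) rho by apply: rle_trans nrho => /=.
exact: (@cat_step (Fin n.+1) (Fin n) erefl (merge_step nrho' (IH nrho'))).
Qed.

Lemma cat_two_ended n L R X el er : rle (Fin n) rho ->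
  [/\ good L, nontrivial L, rle (walk_rank L) (Fin n),
      (walk_rank L = Fin n -> finite L) & reaches_right L X] ->
  [/\ good R, nontrivial R, rle (walk_rank R) (Fin n),
      (walk_rank R = Fin n -> finite R) & reaches_left R X] ->
  end_left L el -> end_right R er ->
  exists V, [/\ good V, nontrivial V, walk_rank V = Fin n & finite V] /\
    [/\ end_left V el, end_right V er & len_le V L R].
Proof.
move=> nrho [gL nL rL fL /reaches_rightE [eL XeL LeL]].
move=> [gR nR rR fR /reaches_leftE [eR XeR ReR]] Lel Rer.
have [//|L' [[g1 g2 g3 [g4 g4']] [g5 g6 g7]]] := to_rank _ nrho gL nL rL fL Lel LeL.
have [//|R' [[h1 h2 h3 [h4 h4']] [h5 h6 h7]]] := to_rank _ nrho gR nR rR fR ReR Rer.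
have [||V [[v1 v2 v3] [sl sr le]]] := cat_fin nrho (L := L') (R := R') (X := X).
- by split => //; apply/reaches_rightE; exists eL.
- by split => //; apply/reaches_leftE; exists eR.
exists V; split; split => //.
- by rewrite v3.
- split.
    by rewrite -right_infinite_rev => /(sl.1); rewrite right_infinite_rev.
  by move=> /(sr.1).
- exact: sl.2.
- exact: sr.2.
- by move=> f; rewrite -g7 -h7.
Qed.

(** * Merging pieces of rank [VecOmega] *)

Section VecOmegaWalks.
Hypothesis rho_Omega : rho = Omega.

Let fin_rho n : rle (Fin n) rho.
Proof. by rewrite rho_Omega. Qed.

Section Descent.
Variables (c : int) (x : int -> G) (W : int -> prewalk G).
Let L := Walk VecOmega None (Some c) x W.
Hypothesis gL : good L.

Let left_vec : vec_walk c None (Some c) x W.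
Proof.
by have [/is_walk_vec [c' h] _] := gL; have [[_ E _] _ _] := h; move: h; rewrite E.
Qed.

Let node_fin m : m <= c -> natural_rank (rk (x m)).
Proof. by move=> mc; have [_ h _] := left_vec; apply: h. Qed.

Lemma descent_piece m : m < c ->
  [/\ good (W m), nontrivial (W m), reaches_right (W m) (x (m + 1))
    & descends (x m) (W m) (x (m + 1))].
Proof.
move=> mc; have [_ _ h] := left_vec; have [_ [_ i]] := gL.
have mp : in_pieces None (Some c) m by rewrite /in_pieces /=; lia.
have [h1 h2 h3 h4] := h m mp; have -> : c <= m = false by lia.
by move=> h5; split => //; split => //; exact: i.
Qed.

(** The ranks grow strictly towards the infinite end, so far enough out L has a piece of rank at
    least q. *)
Lemma descent_rank (j s : nat) : rk (x (c - j%:Z)) = Fin s -> (j <= s)%N.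
Proof.
elim: j s => [//|j IH] s rs.
have [|_ _ _ [+ _ _]] := @descent_piece (c - j.+1%:Z); first by lia.
have -> : c - j.+1%:Z + 1 = c - j%:Z by lia.
case: (@node_fin (c - j%:Z)); first by lia.
move=> t rt; rewrite rs rt; move: (IH _ rt); rewrite /rlt /=; lia.
Qed.

Variables (Q : prewalk G) (q : nat) (X e : G).
Hypotheses (Xc : embraces X (x c)) (gQ : good Q) (nQ : nontrivial Q) (fQ : finite Q).
Hypotheses (rQ : rle (walk_rank Q) (Fin q)) (XQ : reaches_left Q X) (Qe : end_right Q e).

Lemma descent_merge (j : nat) : exists U,
  [/\ good U, nontrivial U, finite U & end_right U e] /\
  [/\ (forall s : nat, rk (x (c - j%:Z)) = Fin s -> rle (walk_rank U) (Fin (maxn q s)))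
    & exists2 Y, embraces Y (x (c - j%:Z)) & reaches_left U Y].
Proof.
elim: j => [|j [U [[gU nU fU Ue] [rU [Y Yx UY]]]]].
  exists Q; split; split => //.
    by move=> s _; apply: rle_trans rQ _; rewrite /= leq_maxl.
  by exists X => //; rewrite subr0.
have [|gW nW Wr [lt1 lt2 [p rp [inf rWp Wl]]]] := @descent_piece (c - j.+1%:Z); first by lia.
have Ej : c - j.+1%:Z + 1 = c - j%:Z by lia.
rewrite Ej in Wr lt1.
case: (@node_fin (c - j.+1%:Z)); first by lia.
case: (@node_fin (c - j%:Z)); first by lia.
move=> s rs s' rs'; rewrite rs rs' in lt1 lt2.
move/reaches_leftE: (Wl) => [el xel Wel].
have ss' : (s < s')%N by move: lt1; rewrite /rlt /=; lia.
have lt3 : rlt (walk_rank (W (c - j.+1%:Z))) (Fin (maxn q s')).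
  by apply: rlt_le_trans lt2 _; rewrite /= leq_maxr.
have [|||V [[v1 v2 v3 v4] [v5 v6 _]]] :=
    @cat_two_ended (maxn q s') (W (c - j.+1%:Z)) U Y el e _ _ _ Wel Ue.
- exact: fin_rho.
- split => //; first exact: rltW.
    by move=> E; move: lt3; rewrite E => /rlt_irr.
  exact: reaches_right_trans Wr Yx.
- by split => //; apply: rle_trans (rU _ rs) _; rewrite /=; lia.
exists V; split; split => //.
  by move=> s2; rewrite rs' => -[<-]; rewrite v3 rle_refl.
by exists (x (c - j.+1%:Z)); [exact: embraces_refl|apply/reaches_leftE; exists el].
Qed.

(** The merged walk U has rank at most s, where W k has rank s and reaches x k through an s-wtip.
    Concatenating them at rank s keeps this wtip, so the result can serve as the last piece of V.
    The length stays the same because every one-ended [VecOmega]-walk has length omega^omega. *)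
Lemma descent_absorb : exists V,
  [/\ good V, nontrivial V, walk_rank V = VecOmega & ~ right_infinite V] /\
  [/\ sim_left L V, end_right V e & forall f, walk_length V f = walk_length L f].
Proof.
(* With q + 1 steps the rank of x k is at least q + 1, so the piece W k has rank s >= q. *)
pose k := c - q.+1%:Z; have kc : k < c by rewrite /k; lia.
have Ek : k + 1 = c - q%:Z by rewrite /k; lia.
have [U [[gU nU fU Ue] [rU [Y Yx UY]]]] := descent_merge q.
have [gW nW Wr [lt1 lt2 [p rp [inf rWp Wl]]]] := descent_piece kc.
case: (node_fin (ltW kc)) => s' rs'.
have := descent_rank rs'; case: s' rs' => [//|s] rs qs.
have Ep : p = Fin s by move: rp; rewrite rs => -[].
rewrite {}Ep in rp rWp.
rewrite Ek in Wr lt1.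
have [s0 rs0] : natural_rank (rk (x (c - q%:Z))) by apply: node_fin; lia.
have s0s : (s0 <= s)%N by move: lt1; rewrite rs0 rs /rlt /=; lia.
have rUs : rle (walk_rank U) (Fin s).
  by apply: rle_trans (rU _ rs0) _; rewrite /=; lia.
move/reaches_leftE: UY => [eU YeU UeU].
have [//|U' [[g1 g2 g3 [g4 g4']] [g5 g6 g7]]] :=
  to_rank _ (fin_rho s) gU nU rUs (fun=> fU) UeU Ue.
(* A right s-wtip would belong to a wnode of rank s + 1, too large to be embraced by x (c - q). *)
have finW : ~ right_infinite (W k).
  move=> infW; move/reaches_rightE: Wr => [e' xe' We'].
  have := end_right_infinite hG infW We'; rewrite rWp.
  have := embraces_le hG xe'; rewrite rs0.
  by case: (rk e') => [[|t]||] //= h [E]; move: h; rewrite E; lia.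
have [||V0 [[v1 v2 v3] [sl sr _]]] := cat_fin (fin_rho s) (L := W k) (R := U') (X := Y).
- by split => //; exact: reaches_right_trans Wr Yx.
- by split => //; apply/reaches_leftE; exists eU.
rewrite rWp in v3.
have re : rle (rk e) (Fin q).
  by apply: rle_trans rQ; apply: (end_right_rank gQ.1 fQ.2 Qe).
pose x' := fun m => if m <= k then x m else e.
pose W' := fun m => if m < k then W m else V0.
pose V := Walk VecOmega None (Some (k + 1)) x' W'.
have wV : is_walk V.
  have [_ h1 h2] := left_vec.
  apply/is_walk_vec; exists (k + 1); split.
  - by split => //; left.
  - move=> m _; rewrite /x'; case: ifP => mk; first by apply: h1; rewrite /in_nodes /=; lia.
    by case: (rk e) re => // t _; exists t.
  - move=> m; rewrite {1}/in_pieces /= => mk.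
    rewrite /vec_piece; have -> : (k + 1 <= m) = false by lia.
    rewrite /W' /x'; have -> : m <= k by lia.
    case: ifP => mk'.
      have -> : m + 1 <= k by lia.
      by have := h2 m ltac:(rewrite /in_pieces /=; lia); rewrite /vec_piece; have -> : c <= m = false by lia.
    have Em : m = k by lia.
    have -> : (m + 1 <= k) = false by lia.
    rewrite Em; have Vk : reaches_left_by (Fin s) V0 (x k).
      by apply: sim_left_by sl _; rewrite // v3 rWp.
    split => //; first by case: v1.
    + by case: Vk.
    + by apply/reaches_rightE; exists e; [exact: embraces_refl|exact: sr.2].
    + split; rewrite ?rs ?v3.
      * by apply: rle_lt_trans re _; rewrite /rlt /=; lia.
      * by rewrite /rlt /= ltnn.
      * by exists (Fin s).
exists V; split; split => //.
- split => //; have [_ [i1 i2]] := gL; split => m mn.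
    rewrite /x'; case: ifP => mk; first by apply: i1; rewrite /in_nodes /=; lia.
    by apply: (end_right_in gQ _ Qe); apply: rle_trans re (fin_rho q).
  by rewrite /W'; case: ifP => mk; [apply: i2; rewrite /in_pieces /=; lia|case: v1].
- by exists k; rewrite /in_pieces /=; lia.
- have wr := is_walk_rev (wg_adj_sym hG) wV; split => // e'.
  apply: (@end_right_far G nu hG VecOmega _ _ _ _ _ _ 0 (- k + 1) e' wr) => i ik.
  rewrite addr0 /x' /W'.
  by have [-> ->] : (- i <= k) /\ (- i - 1 < k) by lia.
- by rewrite /= /x'; have -> : (k + 1 <= k) = false by lia.
Qed.

End Descent.

Lemma vec_absorb L Q X e :
  [/\ good L, walk_rank L = VecOmega, ~ right_infinite L & reaches_right L X] ->
  [/\ good Q, nontrivial Q, finite Q, natural_rank (walk_rank Q) & reaches_left Q X] ->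
  end_right Q e ->
  exists V,
  [/\ good V, nontrivial V, walk_rank V = VecOmega & ~ right_infinite V] /\
  [/\ sim_left L V, end_right V e & forall f, walk_length V f = walk_length L f].
Proof.
case: L => [u v|r lo [c|] x W] [gL rL fL LX] [gQ nQ fQ [q rQ] QX] Qe //; last by case: fL.
rewrite /= in rL; subst r.
have [/is_walk_vec [c' [[_ _ Eends] _ _]] _] := gL.
have Elo : lo = None by case: Eends.
have rQ' : rle (walk_rank Q) (Fin q) by rewrite rQ rle_refl.
by subst lo; apply: (descent_absorb gL LX gQ nQ fQ rQ' QX Qe).
Qed.

(** The walk is lifted to rank n + 1 because an infinite n-walk becomes two-ended only as a piece of
    a walk of higher rank. *)
Lemma two_ended_lift w el er : good w -> nontrivial w -> natural_rank (walk_rank w) ->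
  end_left w el -> end_right w er ->
  exists R, [/\ good R, nontrivial R, natural_rank (walk_rank R) & finite R] /\
    [/\ end_left R el, end_right R er & forall f, walk_length R f = walk_length w f].
Proof.
move=> gw nw [n rw] wl wr.
have [//| | |R [[g1 g2 g3 g4] g5]] := @to_rank (Fin n.+1) w el er _ (fin_rho _) gw nw _ _ wl wr.
- by rewrite rw /=.
- by rewrite rw => -[]; lia.
by exists R; split => //; split => //; exists n.+1.
Qed.

Lemma merge_vec_fin L R X xr :
  [/\ good L, walk_rank L = VecOmega, ~ right_infinite L & reaches_right L X] ->
  [/\ good R, nontrivial R, natural_rank (walk_rank R), reaches_left R X & reaches_right R xr] ->
  exists V, [/\ good V, nontrivial V, walk_rank V = VecOmega & len_le V L R] /\
    (sim_left L V /\ reaches_right V xr).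
Proof.
move=> hL [gR nR rR /reaches_leftE [el Xel Rel] /reaches_rightE [er xer Rer]].
have [Q [[g1 g2 g3 g4] [g5 g6 _]]] := two_ended_lift gR nR rR Rel Rer.
have [|V [[v1 v2 v3 v4] [v5 v6 v7]]] := vec_absorb hL _ g6.
  by split => //; apply/reaches_leftE; exists el.
exists V; split; split => //.
  by move=> f; rewrite v7 leq_addr.
by apply/reaches_rightE; exists er.
Qed.

(** An endless [VecOmega]-walk needs a common starting wnode of its halves, whereas those of L and R
    are merely embraced by X. So the piece of L next to X is cut off and absorbed into R, which then
    starts exactly where the rest of L does. *)
Lemma merge_vec_vec L R X :
  [/\ good L, walk_rank L = VecOmega, ~ right_infinite L & reaches_right L X] ->
  [/\ good R, walk_rank R = VecOmega, ~ left_infinite R & reaches_left R X] ->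
  exists V, [/\ good V, nontrivial V, walk_rank V = VecOmega & len_le V L R] /\
    (sim_left L V /\ sim_right R V).
Proof.
case: L => [u v|r lo [c|] x W] [gL rL fL LX] [gR rR fR RX] //; last by case: fL.
rewrite /= in rL; subst r.
have [/is_walk_vec [c' [[_ Ec Eends] h1 h2]] _] := gL.
have Elo : lo = None by case: Eends.
subst lo c'.
have c1 : c - 1 < c by lia.
have [gW nW Wr [lt1 lt2 [p rp [inf rWp Wl]]]] := descent_piece gL c1.
rewrite subrK in Wr.
move/reaches_leftE: Wl => [el xel Wel]; move/reaches_rightE: Wr => [er xer Wer].
(* The wnode containing the wtip has the same rank as x (c - 1), which embraces it. *)
have Eel : x (c - 1) = el.
  apply: (embraces_eq hG xel).
  have := end_left_infinite hG inf Wel; rewrite rWp => rel.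
  by rewrite (rpred_inj rp rel) rle_refl.
have natW : natural_rank (walk_rank (W (c - 1))).
  have [n rn] : natural_rank (rk (x (c - 1))) by apply: h1; rewrite /in_nodes /=; lia.
  by apply: (@rlt_fin n); rewrite -rn.
have [Q [[q1 q2 q3 q4] [q5 q6 _]]] := two_ended_lift gW nW natW Wel Wer.
have [|||V [[v1 v2 v3 v4] [v5 v6 v7]]] := @vec_absorb (rev_walk R) (rev_walk Q) X el.
- split; [exact: good_rev|by rewrite walk_rank_rev|by rewrite right_infinite_rev|].
  by rewrite reaches_right_rev.
- split; [exact: good_rev|exact: nontrivial_rev| |by rewrite walk_rank_rev|].
    by case: q4 => qa qb; split; rewrite ?left_infinite_rev ?right_infinite_rev.
  rewrite reaches_left_rev; apply: reaches_right_trans LX.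
  by apply/reaches_rightE; exists er.
- exact: q5.
have gV := good_rev v1.
have nV : nontrivial (rev_walk V) by exact: nontrivial_rev.
have lV f : walk_length (rev_walk V) f = walk_length R f.
  by rewrite walk_length_rev ?v7 ?walk_length_rev //; [case: gR|case: v1].
have sV : sim_right R (rev_walk V) by move: v5; rewrite /sim_left rev_walkK.
have eV : end_right (rev_walk (rev_walk V)) el by rewrite rev_walkK.
have fV : ~ left_infinite (rev_walk V) by rewrite left_infinite_rev.
have rV : walk_rank (rev_walk V) = VecOmega by rewrite walk_rank_rev.
move: (rev_walk V) gV nV lV sV eV fV rV => U gV nV lV sV eV fV rV.
case: U gV nV lV sV eV fV rV => [u v|r [a|] hi y Z] gV nV lV sV eV fV rV //; last by case: fV.
rewrite /= in rV; subst r.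
have [/is_walk_vec [c' [[_ _ Eends'] _ _]] _] := gV.
have Ehi : hi = None by case: Eends'.
subst hi.
pose L' := Walk VecOmega None (Some (c - 1)) x W.
have sub : part_of 0 None (Some c) x W None (Some (c - 1)) x W.
  by apply: part_cut => m; rewrite /in_nodes /=; lia.
have wL' : is_walk L'.
  apply/is_walk_vec; exists (c - 1); apply: (part_vec_walk _ sub (c := c)).
  - by split => //; left.
  - by move=> m; rewrite /in_pieces /= addr0; lia.
  - by split.
have gL' : good L' by split => //; exact: part_walk_in sub gL.2.
have eab : x (c - 1) = y a by rewrite Eel; move: eV; rewrite /= opprK.
have ww := glue_is_walk_vec gL' gV eab erefl erefl erefl.
have [[w1 w2 w3] [w4 w5 w6]] := glue_spec gL' gV eab ww (or_intror nV).
eexists; split; split; [exact: w1|exact: w2|exact: w3| | |].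
- by move=> f; apply: leq_trans (w6 f) _; rewrite lV.
- apply: sim_left_trans w4.
  have wr := is_walk_rev (wg_adj_sym hG) wL'; split => // e'.
  by apply: (@end_right_far G nu hG VecOmega _ _ _ _ _ _ 0 0 e' wr) => i _; rewrite addr0.
- exact: sim_right_trans sV w5.
Qed.

(** A piece of natural rank has no [VecOmega]-wtip to preserve, so only the wnodes that it reaches
    matter, and a [VecOmega]-piece next to it can absorb it. *)
Lemma merge_omega : mergeable Omega VecOmega.
Proof.
move=> L R X xl xr [gL nL rL Lxl LX] [gR nR rR RX Rxr] fL fR.
have cases w : rlt (walk_rank w) Omega -> natural_rank (walk_rank w) \/ walk_rank w = VecOmega.
  by case: (walk_rank w) => [n||] // _; [left; exists n|right].
have notby w : natural_rank (walk_rank w) -> walk_rank w = VecOmega -> False.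
  by case=> n ->.
case: (cases L rL) => kL; case: (cases R rR) => kR.
- have [n En] := kL; have [m Em] := kR.
  move/reaches_leftE: Lxl => [el xel Lel]; move/reaches_rightE: Rxr => [er xer Rer].
  (* This rank exceeds both ranks, so that even infinite pieces can be bracketed. *)
  have [||V [[v1 v2 v3 v4] [v5 v6 v7]]] := @cat_two_ended (maxn n m).+1 L R X el er (fin_rho _) _ _ Lel Rer.
  + by split => //; rewrite En /=; [lia|move=> [] ; lia].
  + by split => //; rewrite Em /=; [lia|move=> [] ; lia].
  exists V; split; split => //.
  + by rewrite v3.
  + by apply/reaches_leftE; exists el.
  + by apply/reaches_rightE; exists er.
  + by case=> _ /(notby _ kL).
  + by case=> _ /(notby _ kR).
- have [||V [[v1 v2 v3 v4] [v5 v6]]] := @merge_vec_fin (rev_walk R) (rev_walk L) X xl.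
  + split; [exact: good_rev|by rewrite walk_rank_rev| |by []].
    by rewrite right_infinite_rev => inf; apply: fR.
  + split; [exact: good_rev|exact: nontrivial_rev|by rewrite walk_rank_rev| |by []].
    by rewrite reaches_left_rev.
  have sV : sim_right R (rev_walk V) by move: v5; rewrite /sim_left rev_walkK.
  exists (rev_walk V); split; split => //.
  + exact: good_rev.
  + exact: nontrivial_rev.
  + by rewrite walk_rank_rev v3.
  + move=> f; rewrite walk_length_rev; last by case: v1.
    have := v4 f; rewrite !walk_length_rev; [by rewrite addnC|by case: gL|by case: gR].
  + by rewrite reaches_left_rev.
  + exact: sim_right_reaches sV Rxr.
  + by case=> _ /(notby _ kL).
  + by apply: sim_right_by sV; rewrite walk_rank_rev v3 kR.
- have [||V [[v1 v2 v3 v4] [v5 v6]]] := @merge_vec_fin L R X xr.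
  + by split => //; move=> inf; apply: fL.
  + by [].
  exists V; split; split => //.
  + by rewrite v3.
  + exact: sim_left_reaches v5 Lxl.
  + by apply: sim_left_by v5; rewrite v3 kL.
  + by case=> _ /(notby _ kR).
- have [||V [[v1 v2 v3 v4] [v5 v6]]] := @merge_vec_vec L R X.
  + by split => //; move=> inf; apply: fL.
  + by split => //; move=> inf; apply: fR.
  exists V; split; split => //.
  + by rewrite v3.
  + exact: sim_left_reaches v5 Lxl.
  + exact: sim_right_reaches v6 Rxr.
  + by apply: sim_left_by v5; rewrite v3 kL.
  + by apply: sim_right_by v6; rewrite v3 kR.
Qed.

End VecOmegaWalks.

Lemma cat_any : rho <> VecOmega -> concatenable rho.
Proof.
move=> rV; case E : rho rV => [n||] // _.
  by apply: cat_fin; rewrite E rle_refl.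
by apply: (@cat_step Omega VecOmega erefl); exact: merge_omega.
Qed.

End Concatenation.

(** * Wdistances *)

Section Distance.
Local Open Scope ring_scope.
Variables (G : wdata) (nu : rank) (hG : is_wgraph G nu) (rho : rank) (S : wsubgraph G).
Hypothesis rho_vec : rho <> VecOmega.
Hypothesis S_sym : forall u v, sadj S u v -> sadj S v u.
Hypothesis S_tip : forall e t w, rle (rk e) rho -> tips e t -> t w ->
  walk_in setT (sadj S) w -> snode S e.
Hypothesis S_rank : forall x, snode S x -> rle (rk x) rho.
Hypothesis S_whole : natural_rank rho \/ rho = Omega /\ snode S = setT.
Hypothesis S_connected : wconnected rho S.
Implicit Types (u v x y z X Y : G) (w : prewalk G) (k : nat).

Let eps := expo_rank rho.
Let goodS := good (snode S) (sadj S).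

Lemma expo_len_le r s : rlt r s -> s <> VecOmega -> (expo_len r <= expo_rank s)%O.
Proof.
move=> rs sV; rewrite leNgt expo_ltE.
by case: r s rs sV => [n||] [m||] //; rewrite /rlt /=; lia.
Qed.

Lemma expo_rank_lt r s : rlt r s -> r <> VecOmega -> s <> VecOmega ->
  (expo_rank r < expo_rank s)%O.
Proof.
by move=> rs rV sV; rewrite expo_ltE; case: r s rs rV sV => [n||] [m||] //; rewrite /rlt /=; lia.
Qed.

Lemma two_ended_rank w : is_walk w -> finite w -> walk_rank w <> VecOmega.
Proof.
case: w => // r [a|] [b|] x W ww [fl fr] //= rV; [|by case: fr|by case: fl|by case: fr].
by subst r; case/is_walk_vec: ww => c [[_ _ []]].
Qed.

(** An infinite r-walk has exponent r + 1, or omega for r = [VecOmega], and therefore needs r < s. A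
    two-ended walk of rank at most s is a sum over branches or pieces of rank below s. *)
Lemma walk_length_bounded w s : is_walk w -> s <> VecOmega ->
  (finite w /\ rle (walk_rank w) s) \/ rlt (walk_rank w) s ->
  bounded (expo_rank s) (walk_length w).
Proof.
elim: w => // r lo hi x W IH ww sV rs f sf.
have infinite k : ~ finite (Walk r lo hi x W) -> wpow (expo_len r) k f = 0%N.
  move=> nf; case: rs => [[//]|/= rs]; rewrite wpowE; case: eqP => // E.
  by have := expo_len_le rs sV; rewrite -E leNgt sf.
case: lo hi ww IH rs infinite => [a|] [b|] ww IH rs infinite;
  [|by apply: infinite => -[_ /(_ I)]|by apply: infinite => -[/(_ I)]|by apply: infinite => -[/(_ I)]].
rewrite walk_length_two; apply: big1 => i _.
have rs' : rle r s by case: rs => [[]|/rltW].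
have mp : in_pieces (Some a) (Some b) (a + i%:Z).
  by rewrite /in_pieces /=; move: (ltn_ord i) (is_walk_lohi ww); rewrite /lohi; lia.
have reg p : rpred r = Some p -> walk_length (W (a + i%:Z)%R) f = 0%N.
  move=> rp; have /(is_walk_reg _ _ _ _ rp) [_ _ _ h _] := ww.
  have [h1 _ h3 _ _] := h _ mp; apply: IH sf => //.
  by right; exact: rlt_le_trans h3 rs'.
case: r ww rs rs' infinite reg => [[|n]||] ww rs rs' infinite reg.
- have /is_walk_0 [_ _ h] := ww; have [-> _] := h _ mp.
  rewrite /= wpowE; case: eqP => // E.
  by move: sf; rewrite E expo_ltE /=; lia.
- exact: (reg (Fin n)).
- by case/is_walk_vec: ww => c [[_ _ []]].
- exact: (reg VecOmega).
Qed.

Lemma low_rank_length w : is_walk w -> finite w -> rlt (walk_rank w) rho ->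
  walk_length w eps = 0%N.
Proof.
move=> ww fw wr; have wV := two_ended_rank ww fw.
apply: (walk_length_bounded ww wV); first by left; rewrite rle_refl.
exact: expo_rank_lt.
Qed.

(** The value 2 comes from the length omega^rho * 2 of an endless piece of rank rho - 1; a two-ended
    piece contributes 0. For rho = 0 a piece is a branch and contributes 1. *)
Lemma piece_length_le lo hi (x : int -> G) W m : is_walk (Walk rho lo hi x W) ->
  in_pieces lo hi m -> (walk_length (W m) eps <= 2)%N.
Proof.
move=> ww mp.
have reg p : rpred rho = Some p -> (walk_length (W m) eps <= 2)%N.
  move=> rp; have /(is_walk_reg _ _ _ _ rp) [_ _ _ h _] := ww.
  have [h1 _ h3 _ _] := h _ mp.
  have [fw|nf] := EM (finite (W m)); first by rewrite low_rank_length.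
  move: nf; case: (W m) => [a b|r [a|] [b|] x' W'] nf /=.
  - by rewrite wpowE; case: ifP.
  - by case: nf; split.
  - by rewrite wpowE; case: ifP.
  - by rewrite wpowE; case: ifP.
  - by rewrite wpowE; case: ifP.
case E : rho reg => [[|n]||] reg.
- move: ww; rewrite E => /is_walk_0 [_ _ h]; have [-> _] := h _ mp.
  by rewrite /= wpowE; case: ifP.
- exact: (reg (Fin n)).
- by case: rho_vec.
- exact: (reg VecOmega).
Qed.

(** Amounts to [wcoef x y <= k], in terms of walks of rank exactly rho, to which [concatenable]
    applies. The first alternative accounts for the wdistance 0. *)
Definition near x y k : Prop :=
  (exists X, [/\ maximal_node S X, embraces X x & embraces X y]) \/
  exists w X Y, [/\ goodS w, nontrivial w, walk_rank w = rho & finite w] /\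
    [/\ maximal_node S X /\ embraces X x, maximal_node S Y /\ embraces Y y,
        reaches_left w X, reaches_right w Y & (walk_length w eps <= k)%N].

Lemma near_sym x y k : near x y k -> near y x k.
Proof.
case=> [[X [mX Xx Xy]]|[w [X [Y [[gw nw rw [fl fr]] [hX hY wX wY le]]]]]].
  by left; exists X.
right; exists (rev_walk w), Y, X; split; split => //.
- exact: (good_rev hG).
- exact: nontrivial_rev.
- by rewrite walk_rank_rev.
- by split; rewrite ?left_infinite_rev ?right_infinite_rev.
- by rewrite reaches_left_rev.
- by rewrite walk_length_rev //; case: gw.
Qed.

Lemma near_trans y x z j k : near x y j -> near y z k -> near x z (j + k).
Proof.
have uniq := maximal_unique hG (S := S).
case=> [[X [mX Xx Xy]]|[w [X [Y [[gw nw rw [fl fr]] [[mX Xx] [mY Yy] wX wY le]]]]]];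
  case=> [[X' [mX' Xx' Xy']]|[w' [X' [Y' [[gw' nw' rw' [fl' fr']] [[mX' Xx'] [mY' Yy'] wX' wY' le']]]]]].
- by left; exists X; split => //; rewrite (uniq _ _ _ mX mX' Xy Xx').
- have E := uniq _ _ _ mX mX' Xy Xx'; subst X'.
  right; exists w', X, Y'; split; split => //.
  exact: leq_trans le' (leq_addl _ _).
- have E := uniq _ _ _ mY mX' Yy Xx'; subst X'.
  right; exists w, X, Y; split; split => //.
  exact: leq_trans le (leq_addr _ _).
- have E := uniq _ _ _ mY mX' Yy Xx'; subst X'.
  have [||V [[v1 v2 v3] [sl sr lV]]] := cat_any hG S_sym S_tip rho_vec (L := w) (R := w') (X := Y).
  + by split.
  + by split.
  right; exists V, X, Y'; split; split => //.
  + by rewrite v3.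
  + split; last by move=> /(sr.1).
    by rewrite -right_infinite_rev => /(sl.1); rewrite right_infinite_rev.
  + exact: sim_left_reaches sl wX.
  + exact: sim_right_reaches sr wY'.
  + by apply: leq_trans (lV eps) _; apply: leq_add.
Qed.

Lemma wdist_common x y :
  (exists X, [/\ maximal_node S X, embraces X x & embraces X y]) ->
  wdist rho S x y = mset0%mset.
Proof. by move=> h; rewrite /wdist; case: asboolP. Qed.

Lemma wdist_walk x y : snode S x -> snode S y ->
  ~ (exists X, [/\ maximal_node S X, embraces X x & embraces X y]) ->
  walk_lengths rho S x y (wdist rho S x y) /\
  forall d, walk_lengths rho S x y d -> ole (wdist rho S x y) d.
Proof.
move=> Sx Sy h; rewrite /wdist; case: asboolP => // _.
have [X [mX Xx]] := maximal_exists hG S_rank S_whole Sx.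
have [Y [mY Yy]] := maximal_exists hG S_rank S_whole Sy.
have [w [a [b [ww wab xa yb]]]] := S_connected Sx Sy.
(* S is wconnected, so the set of lengths is nonempty and the default value of [xget] does not
   occur. *)
have [|d Ad dmin] := @ord_min (walk_lengths rho S x y).
  exists (walk_length w), w, a, b, X, Y; split => //.
    by split => //; exact: embraces_trans Xx xa.
  by split => //; exact: embraces_trans Yy yb.
exact: (@xgetPex _ _ [set d | _ /\ _] (ex_intro _ d (conj Ad dmin))).
Qed.

Definition wcoef x y : nat := wdist rho S x y eps.

Lemma walk_lengths_bounded x y d : walk_lengths rho S x y d -> bounded eps d.
Proof.
case=> w [a [b [X [Y [[[ww rw _] wab] _ _ ->]]]]].
apply: (walk_length_bounded ww rho_vec); left; split => //.
by move: wab; case: (w) => // r [i|] [j|] // x' W' _; split.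
Qed.

Lemma wdist_bounded x y : snode S x -> snode S y -> bounded eps (wdist rho S x y).
Proof.
move=> Sx Sy; have [h|h] := EM (exists X, [/\ maximal_node S X, embraces X x & embraces X y]).
  by rewrite wdist_common // => f _; rewrite mset0E.
by have [/walk_lengths_bounded] := wdist_walk Sx Sy h.
Qed.

Lemma near_wcoef x y : snode S x -> snode S y -> near x y (wcoef x y).
Proof.
move=> Sx Sy; have [h|h] := EM (exists X, [/\ maximal_node S X, embraces X x & embraces X y]).
  by left.
have [[w [a [b [X [Y [[[ww rw iw] wab] [mX Xx Xa] [mY Yy Yb] E]]]]]] _] := wdist_walk Sx Sy h.
case: w ww rw iw wab E => // r [i|] [j|] // x' W' ww rw iw [ia jb] E.
have ij := is_walk_lohi ww; rewrite /lohi in ij.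
set w := Walk _ _ _ _ _ in ww rw iw E.
(* A trivial walk would put x and y under the same maximal wnode. *)
have nw : nontrivial w.
  have [Eij|nij] := eqVneq i j.
    case: h; exists X; split => //; have Eab : a = b by rewrite -ia -jb Eij.
    by rewrite (maximal_unique hG mX mY Xa (y := a)) ?Eab.
  by exists i; rewrite /in_pieces /=; move: nij ij => /eqP; lia.
have wl : end_left w a by rewrite /end_left /= opprK.
have fw : finite w by split.
have [R [[g1 g2 g3 g4] [g5 g6 g7]]] :=
  to_rank hG S_sym S_tip rho_vec (rle_refl rho) (conj ww iw : goodS w) nw rw (fun=> fw) wl jb.
right; exists R, X, Y; split; split => //.
- by apply/reaches_leftE; exists a.
- by apply/reaches_rightE; exists b.
- by rewrite g7 /wcoef E.
Qed.

Lemma wcoef_le x y k : snode S x -> snode S y -> near x y k -> (wcoef x y <= k)%N.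
Proof.
move=> Sx Sy hk; rewrite /wcoef; have [h|h] := EM (exists X, [/\ maximal_node S X, embraces X x & embraces X y]).
  by rewrite wdist_common // mset0E.
case: hk => [//|[w [X [Y [[gw nw rw [fl fr]] [[mX Xx] [mY Yy] wX wY le]]]]]].
have [_ dmin] := wdist_walk Sx Sy h.
have [ww iw] := gw.
have mem : walk_lengths rho S x y (walk_length w).
  case: w gw nw rw fl fr wX wY le ww iw => // r [i|] [j|] x' W' // gw nw rw fl fr wX wY le ww iw;
    try by [case: fl|case: fr].
  rewrite /= in rw; subst r.
  exists (Walk rho (Some i) (Some j) x' W'), (x' i), (x' j), X, Y; split => //.
  - by split; split => //=; exact: rle_refl.
  - by split => //; move: wX; rewrite /reaches_left /= opprK.
apply: leq_trans (ole_lead _ _ (dmin _ mem)) le.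
  exact: wdist_bounded.
exact: walk_lengths_bounded mem.
Qed.

Lemma wcoefxx x : snode S x -> wcoef x x = 0%N.
Proof.
move=> Sx; have [X [mX Xx]] := maximal_exists hG S_rank S_whole Sx.
by rewrite /wcoef wdist_common ?mset0E //; exists X.
Qed.

Lemma wcoef_sym x y : snode S x -> snode S y -> wcoef x y = wcoef y x.
Proof.
by move=> Sx Sy; apply/eqP; rewrite eqn_leq; apply/andP; split;
  apply: wcoef_le => //; apply/near_sym/near_wcoef.
Qed.

Lemma wcoef_triangle y x z : snode S x -> snode S y -> snode S z ->
  (wcoef x z <= wcoef x y + wcoef y z)%N.
Proof.
by move=> Sx Sy Sz; apply: wcoef_le => //; apply: (@near_trans y); exact: near_wcoef.
Qed.

Lemma wdist_ole_wcoef x y k : snode S x -> snode S y ->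
  ole (wdist rho S x y) (wpow eps k) -> (wcoef x y <= k)%N.
Proof.
move=> Sx Sy /ole_lead h; have := h eps; rewrite wpowE eqxx; apply.
  exact: wdist_bounded.
by move=> f ef; rewrite wpowE; case: eqP ef => // ->; rewrite ltxx.
Qed.

Lemma wcoef_lt_ole x y x' y' k : snode S x -> snode S y -> snode S x' -> snode S y' ->
  (wcoef x y + k < wcoef x' y')%N ->
  ole (nsum (wdist rho S x y) (wpow eps k)) (wdist rho S x' y').
Proof.
move=> Sx Sy Sx' Sy' h; apply: (@lead_ole eps).
- move=> f ef; rewrite nsumE wdist_bounded // wpowE; case: eqP ef => // ->.
  by rewrite ltxx.
- exact: wdist_bounded.
- by rewrite nsumE wpowE eqxx.
Qed.

Lemma wcoef_lt_wpow x y k : snode S x -> snode S y -> (wcoef x y < k)%N ->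
  ole (wdist rho S x y) (wpow eps k).
Proof.
move=> Sx Sy h; apply: (@lead_ole eps).
- exact: wdist_bounded.
- by move=> f ef; rewrite wpowE; case: eqP ef => // ->; rewrite ltxx.
- by rewrite wpowE eqxx.
Qed.

(* Along a walk of rank rho from x to z the coefficient of the wdistance to x
   grows by at most 2 at each step. *)
Lemma intermediate_node x z t : snode S x -> snode S z -> (t + 3 <= wcoef x z)%N ->
  exists y, [/\ snode S y, rk y = rho & (t <= wcoef x y <= t + 2)%N].
Proof.
move=> Sx Sz ht.
have [h|h] := EM (exists X, [/\ maximal_node S X, embraces X x & embraces X z]).
  by move: ht; rewrite /wcoef wdist_common // mset0E; lia.
have [[w [a [b [X [Y [[[ww rw iw] wab] [mX Xx Xa] [mY Yy Yb] E]]]]]] _] := wdist_walk Sx Sz h.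
case: w ww rw iw wab E => // r [i|] [j|] // x' W' ww rw [i1 i2] [ia jb] E.
(* A two-ended walk of rank below rho has coefficient 0. *)
case: (rle_eqVlt rw) => [/= rr|rlt]; last first.
  by move: ht; rewrite /wcoef E low_rank_length //; [lia|split].
subst r; have ij := is_walk_lohi ww; rewrite /lohi in ij.
have Sx' m : i <= m <= j -> snode S (x' m).
  by move=> hm; apply: i1; rewrite /in_nodes /=.
pose g n := wcoef x (x' (i + n%:Z)).
have g0 : g 0%N = 0%N.
  by rewrite /g addr0 /wcoef wdist_common ?mset0E //; exists X; split => //; rewrite ia.
(* The part of the walk consisting of a single piece bounds the wdistance of its two wnodes. *)
have gS n : i + n.+1%:Z <= j -> (g n.+1 <= g n + 2)%N.
  move=> nj; have S1 : snode S (x' (i + n%:Z)) by apply: Sx'; lia.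
  have S2 : snode S (x' (i + n.+1%:Z)) by apply: Sx'; lia.
  apply: leq_trans (wcoef_triangle Sx S1 S2) _; rewrite leq_add2l.
  apply: wcoef_le => //; right.
  have [X1 [mX1 Xx1]] := maximal_exists hG S_rank S_whole S1.
  have [X2 [mX2 Xx2]] := maximal_exists hG S_rank S_whole S2.
  set m := i + n%:Z in X1 mX1 Xx1 S1 *.
  have Em : i + n.+1%:Z = m + 1 by rewrite /m; lia.
  rewrite Em in X2 mX2 Xx2 S2 *.
  have sub : part_of 0 (Some i) (Some j) x' W' (Some m) (Some (m + 1)) x' W'.
    by apply: part_cut => q; rewrite /in_nodes /m /=; lia.
  exists (Walk rho (Some m) (Some (m + 1)) x' W'), X1, X2; split; split => //.
  - split; last by apply: part_walk_in sub _; split.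
    by apply: (part_is_walk rho_vec _ sub ww); rewrite /lohi; lia.
  - by exists m; rewrite /in_pieces /=; lia.
  - by split.
  - by rewrite /reaches_left /= opprK.
  - rewrite walk_length_two; have -> : absz (m + 1 - m)%R = 1%N by lia.
    rewrite piece_sum1; apply: piece_length_le ww _.
    by rewrite /in_pieces /m /=; lia.
pose N := absz (j - i)%R.
have gN : (t + 3 <= g N)%N.
  have EN : i + N%:Z = j by rewrite /N; lia.
  apply: leq_trans ht _; have Sj : snode S (x' j) by apply: Sx'; lia.
  apply: leq_trans (wcoef_triangle Sx Sj Sz) _; rewrite /g EN.
  have -> : wcoef (x' j) z = 0%N by rewrite /wcoef wdist_common ?mset0E //; exists Y; rewrite jb.
  by rewrite addn0.
(* The first index where g exceeds t is not 0, as g 0 = 0, and not the last, where g is at least t +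
   3 whereas g has only just passed t by a step of at most 2. So the wnode there is nonterminal. *)
have ex : exists n, (t < g n)%N by exists N; lia.
case: (ex_minnP ex) => -[|n] tn nmin; first by move: tn; rewrite g0.
have gn : (g n <= t)%N by rewrite leqNgt; apply/negP => /nmin; rewrite ltnn.
have nN : (n.+1 <= N)%N by apply: nmin; lia.
have gn1 : (g n.+1 <= t + 2)%N by have := gS n ltac:(rewrite /N in nN; lia); lia.
have nN' : (n.+1 < N)%N.
  by rewrite ltn_neqAle nN andbT; apply/eqP => EN; move: gN; rewrite -EN; lia.
have mn : nonterminal (Some i) (Some j) (i + n.+1%:Z).
  by rewrite /nonterminal /= /N in nN' *; lia.
exists (x' (i + n.+1%:Z)); split.
- by apply: Sx'; rewrite /N in nN'; lia.
- have [mn' _ _] := nonterminal_nodes mn.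
  case Er : rho (rho_vec) => [[|q]||] // _; rewrite Er in ww.
  + by move/is_walk_0: ww => [_ h' _]; exact: h'.
  + by move/(@is_walk_reg _ _ (Fin q)): ww => /(_ erefl) [_ _ h' _ _]; exact: h'.
  + by move/(@is_walk_reg _ _ VecOmega): ww => /(_ erefl) [_ _ h' _ _]; exact: h'.
- by apply/andP; split; [exact: ltnW|].
Qed.

(** * Galaxies *)

Section Galaxies.
Variables (F : set_system nat) (F_ultra : UltraFilter F).
Implicit Types (H K : hypernode G) (p q : nat -> G).

Let hyper := is_hypernode rho S F.
Let limited := limitedly_distant rho S F.

Lemma hyper_snode H p n : hyper H -> H p -> snode S (p n).
Proof. by case=> g _ [p0 _ ->] [/(_ n) []]. Qed.

Lemma hyper_eq H p q : hyper H -> H p -> H q -> F [set n | p n = q n].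
Proof.
case=> g _ [p0 _ ->] [_ Fp] [_ Fq].
by apply: filterS (filterI Fp Fq) => n /= [<- <-].
Qed.

Lemma hyperclass_self g p : rank_sequence S g p -> hyperclass S F g p p.
Proof. by move=> rp; split => //; apply: filterS (@filterT _ F _) => n. Qed.

Lemma hyperclass_hyper g p : rle g rho -> rank_sequence S g p ->
  hyper (hyperclass S F g p).
Proof. by move=> gr rp; exists g => //; exists p. Qed.

Lemma limited_wcoef H K p q : hyper H -> hyper K -> H p -> K q -> limited H K ->
  exists m, F [set n | (wcoef (p n) (q n) <= m)%N].
Proof.
move=> hH hK Hp Kq [p' [q' [Hp' Kq' [m Fm]]]]; exists m.
have Fp := hyper_eq hH Hp Hp'; have Fq := hyper_eq hK Kq Kq'.
apply: filterS (filterI Fm (filterI Fp Fq)) => n /= [hm [-> ->]].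
by apply: wdist_ole_wcoef hm; [exact: hyper_snode hH Hp'|exact: hyper_snode hK Kq'].
Qed.

Lemma wcoef_limited H K p q m : hyper H -> hyper K -> H p -> K q ->
  F [set n | (wcoef (p n) (q n) <= m)%N] -> limited H K.
Proof.
move=> hH hK Hp Kq Fm; exists p, q; split => //; exists m.+1.
apply: filterS Fm => n /= hm.
by apply: wcoef_lt_wpow; [exact: hyper_snode hH Hp|exact: hyper_snode hK Kq|].
Qed.

Definition unlimited (f : nat -> nat) : Prop := forall m, F [set n | (m < f n)%N].

Lemma unlimited_contra f m : unlimited f -> ~ F [set n | (f n <= m)%N].
Proof.
move=> fu Fm; have [n /= [h1 h2]] := filter_ex (filterI (fu m) Fm).
by move: h1; rewrite ltnNge h2.
Qed.

(** F contains the set where m is exceeded or its complement; the latter would make H limitedly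
    distant from the standard hypernode of a. *)
Lemma nonprincipal_unlimited H p a : hyper H -> H p -> snode S a ->
  ~ (exists2 H0, standard rho S F H0 & limited H0 H) ->
  unlimited (fun n => wcoef a (p n)).
Proof.
move=> hH Hp Sa nH m.
have ra : rank_sequence S (rk a) (fun=> a) by [].
have hA := hyperclass_hyper (S_rank Sa) ra.
case: (in_ultra_setVsetC [set n | (m < wcoef a (p n))%N] F_ultra) => // Fm.
case: nH; exists (hyperclass S F (rk a) (fun=> a)).
  by split => //; exists a; exact: hyperclass_self.
apply: (wcoef_limited hA hH (hyperclass_self ra) Hp (m := m)).
by apply: filterS Fm => n /= /negP; rewrite -leqNgt.
Qed.

(** Passing from a to another standard wnode b changes coefficients by at most the fixed number
    [wcoef a b]. *)
Lemma unlimited_nonprincipal H p a : hyper H -> H p -> snode S a ->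
  unlimited (fun n => wcoef a (p n)) ->
  ~ (exists2 H0, standard rho S F H0 & limited H0 H).
Proof.
move=> hH Hp Sa pu [H0 [hH0 [b H0b]] lim].
have [m Fm] := limited_wcoef hH0 hH H0b Hp lim.
have Sb : snode S b by exact: (hyper_snode 0 hH0 H0b).
apply: (unlimited_contra (m := wcoef a b + m) pu).
apply: filterS Fm => n /= hm.
apply: leq_trans (wcoef_triangle Sa Sb (hyper_snode n hH Hp)) _.
by rewrite leq_add2l.
Qed.

(* Targets, at every n, for the coefficients of the wdistances to a standard
   wnode; consecutive targets differ by unlimited amounts. *)
Definition target (i : int) (n : nat) : nat :=
  match i with
  | Posz k => (n * k.+1)%N
  | Negz k => (n %/ k.+2)%N
  end.

Lemma target_gap (i j : int) m : i < j ->
  exists M, forall n, (M <= n)%N -> (target i n + m <= target j n)%N.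
Proof.
case: i j => [k|k] [l|l] ij.
- by exists m => n /= mn; have kl : (k < l)%N by []; nia.
- by [].
(* Already n exceeds n / 2 by at least m once n >= 2m, and all other quotients are smaller. *)
- exists (m * 2)%N => n /= mn.
  have h1 : (n %/ k.+2 <= n %/ 2)%N by apply: leq_div2l.
  have h2 : (n %/ 2 * 2 <= n)%N by exact: leq_divM.
  nia.
- have lk : (l < k)%N by move: ij; rewrite !NegzE; lia.
  (* With q = n / (k + 2) >= m (l + 2) one has (q + m)(l + 2) <= q (l + 2) + q (k - l) = q (k + 2)
     <= n. *)
  exists (m * l.+2 * k.+2)%N => n /= mn; rewrite leq_divRL //.
  have h1 : (n %/ k.+2 * k.+2 <= n)%N by exact: leq_divM.
  have h2 : (m * l.+2 <= n %/ k.+2)%N by rewrite leq_divRL.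
  rewrite mulnDl; apply: leq_trans h1.
  have {3}-> : k.+2 = (l.+2 + (k - l))%N by lia.
  rewrite mulnDr leq_add2l; apply: leq_trans h2 _.
  by rewrite leq_pmulr // subn_gt0.
Qed.

Lemma galaxy_sequence (v : hypernode G) : hyper v ->
  ~ gnodes (principal_galaxy rho S F) v ->
  exists C : set (galaxy G),
    [/\ C `<=` is_galaxy rho S F, totally_ordered rho S F C,
        two_way_infinite rho S F C & exists2 g, C g & gnodes g v].
Proof.
move=> hv nv.
have [alpha ar [vs rvs Ev]] := hv.
have vvs : v vs by rewrite Ev; exact: hyperclass_self.
pose a := vs 0%N; have Sa : snode S a by case: (rvs 0%N).
pose c n := wcoef a (vs n).
have cu : unlimited c.
  apply: (nonprincipal_unlimited hv vvs Sa) => -[H0 sH0 lim].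
  by apply: nv; split => //; exists H0.
(* One family Y serves all indices: since c is unlimited, for every t some walk from a to some wnode
   of the sequence [vs] passes the coefficient t. *)
have /choice [Y YP] : forall t, exists y,
    [/\ snode S y, rk y = rho & (t <= wcoef a y <= t + 2)%N].
  move=> t; have [n /= tn] := filter_ex (cu (t + 3)%N).
  apply: (intermediate_node Sa (z := vs n)); first by case: (rvs n).
  exact: ltnW.
(* The target for i = 0 is c n itself, so v can take this place, with its own rank alpha. *)
pose u (i : int) n := if i == 0 then vs n else Y (target i (c n)).
pose gam (i : int) := if i == 0 then alpha else rho.
have ru i : rank_sequence S (gam i) (u i).
  move=> n; rewrite /u /gam; case: eqP => _; first exact: rvs.
  by case: (YP (target i (c n))).
have gr i : rle (gam i) rho by rewrite /gam; case: eqP => _ //; exact: rle_refl.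
pose U i := hyperclass S F (gam i) (u i).
have hU i : hyper (U i) by exact: hyperclass_hyper.
have Uu i : U i (u i) by exact: hyperclass_self.
have Su i n : snode S (u i n) by exact: (hyper_snode n (hU i) (Uu i)).
have cu_target i n : (target i (c n) <= wcoef a (u i n) <= target i (c n) + 2)%N.
  rewrite /u; case: eqP => [->|_]; last by case: (YP (target i (c n))).
  by rewrite /= muln1 leqnn leq_addr.
(* The 3 covers the error 2 in meeting the target and the strictness of the inequality. *)
have gap (i j : int) m : i < j -> F [set n | (wcoef a (u i n) + m < wcoef a (u j n))%N].
  move=> /(target_gap (m + 3)) [M hM]; apply: filterS (cu M) => n /= Mc.
  have := hM _ (ltnW Mc); have := cu_target i n; have := cu_target j n; lia.
(* There is always a previous member, from which the coefficient differs by an unlimited amount. *)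
have unl i : unlimited (fun n => wcoef a (u i n)).
  move=> m; have ii : i - 1 < i by lia.
  by apply: filterS (gap _ _ m ii) => n /=; apply: leq_ltn_trans; exact: leq_addl.
pose g i := galaxy_on S F [set K | is_hypernode rho S F K /\ limited (U i) K].
have gU i : gnodes (g i) (U i).
  split; first exact: hU.
  apply: (wcoef_limited (hU i) (hU i) (Uu i) (Uu i) (m := 0%N)).
  by apply: filterS (@filterT _ F _) => n _ /=; rewrite wcoefxx.
have gG i : is_galaxy rho S F (g i) by exists (U i) => //; exact: hU.
have gP i : g i <> principal_galaxy rho S F.
  move=> E; have := gU i; rewrite E => -[_].
  exact: (unlimited_nonprincipal (hU i) (Uu i) Sa (unl i)).
have ra : rank_sequence S (rk a) (fun=> a) by [].
have hA := hyperclass_hyper (S_rank Sa) ra.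
have gPa : gnodes (principal_galaxy rho S F) (hyperclass S F (rk a) (fun=> a)).
  split; first exact: hA.
  exists (hyperclass S F (rk a) (fun=> a)).
    by split => //; exists a; exact: hyperclass_self.
  apply: (wcoef_limited hA hA (hyperclass_self ra) (hyperclass_self ra) (m := 0%N)).
  by apply: filterS (@filterT _ F _) => n _ /=; rewrite wcoefxx.
have gclose (i j : int) : i < j -> closer rho S F (g i) (g j).
  move=> ij; split; [by split|by split|].
  exists (u i), (u j), (fun=> a); split.
  - by exists (U i).
  - by exists (U j).
  - by exists (hyperclass S F (rk a) (fun=> a)) => //; exact: hyperclass_self.
  - move=> m; apply: filterS (gap _ _ m ij) => n /= h.
    apply: wcoef_lt_ole => //.
    by rewrite (wcoef_sym (Su i n) Sa) (wcoef_sym (Su j n) Sa).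
(* By the triangle inequality a limited distance would bound the unlimited gap. *)
have ginj (i j : int) : i < j -> g i <> g j.
  move=> ij E; have := gU j; rewrite -E => -[_ lim].
  have [m Fm] := limited_wcoef (hU i) (hU j) (Uu i) (Uu j) lim.
  have [n /= [h1 h2]] := filter_ex (filterI (gap _ _ m ij) Fm).
  by have := wcoef_triangle Sa (Su i n) (Su j n); lia.
exists (range g); split.
- by move=> _ [i _ <-]; exact: gG.
- move=> _ _ [i _ <-] [j _ <-] nij; case: (ltgtP i j) => ij.
  + by left; exact: gclose.
  + by right; exact: gclose.
  + by rewrite ij in nij.
- exists g; split => //; split=> [i _|i j _ _ E|//]; first by exists i.
  by have [/ginj|/ginj /(_ (esym E))|] := ltgtP i j.
- exists (g 0); first by exists 0.
  by rewrite Ev; exact: (gU 0).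
Qed.

End Galaxies.

End Distance.

Theorem theorem5p1
  (nu rho : rank) (G : wdata) (S : wsubgraph G) (F : set_system nat)
  (v : hypernode G)
  (hnu : rle (Fin 2) nu)
  (hG : is_wgraph G nu)
  (hGconn : wconnected nu (whole G))
  (hrho : rle rho nu)
  (hrho_vec : rho <> VecOmega)
  (hS : is_wsection nu rho S)
  (hF : free_ultrafilter F)
  (hv : is_hypernode rho S F v)
  (hv0 : ~ gnodes (principal_galaxy rho S F) v) :
  exists C : set (galaxy G),
    [/\ C `<=` is_galaxy rho S F,
        totally_ordered rho S F C,
        two_way_infinite rho S F C
      & exists2 g, C g & gnodes g v].
Proof.
have [S_sym [S_tip [S_rank [S_whole S_conn]]]] :
  (forall u v : G, sadj S u v -> sadj S v u) /\
  (forall (e : G) t w, rle (rk e) rho -> tips e t -> t w ->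
     walk_in setT (sadj S) w -> snode S e) /\
  (forall x : G, snode S x -> rle (rk x) rho) /\
  (natural_rank rho \/ rho = Omega /\ snode S = setT) /\ wconnected rho S.
  case: hS => [[Erho ->]|[lt [S1 S2 ->] conn _]].
    split; first exact: (wg_adj_sym hG).
    split => //; split; first by move=> x _; rewrite Erho; exact: (wg_rank hG).
    split; last by rewrite Erho.
    by case: (rho) hrho_vec => [n||] // _; [left; exists n|right].
  split => //; split.
    move=> e t w er et tw wS; split => //; right; exists t, w; split => //.
    by exists e => //; exact: embraces_refl.
  split; first by move=> x [].
  (* A wsection of rank below nu has natural rank, since rho differs from [VecOmega] and nothing
     lies above [Omega]. *)
  split => //; left.
  by case: (rho) hrho_vec lt => [n||] // _; [exists n|case: (nu)].
exact: (galaxy_sequence hG hrho_vec S_sym S_tip S_rank S_whole S_conn hF.1 hv hv0).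
Qed.
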